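(* (i) There is $c$ such that for all $\epsilon=1/N>0$ and all $t\ge0$, $$\sup_{x_1,x_2\in\Lambda_N:\,|x_1-x_2|=1}\mathbf P_\epsilon[\tau_{x_1,x_2}\ge t]\le\frac{c}{(\epsilon^{-2}t)^{1/2}+1}.$$ (ii) Given any $T>0$, for any $\zeta>0$ and $k\ge1$ there is $c$ such that for all $0<t\le T$ and all $\epsilon=1/N>0$, $$\sup_{x_1,x_2}\mathbf P_\epsilon\big[N_{x_1,x_2,t}\ge(\epsilon^{-2}t)^{1/2+\zeta}\big]\le c(\epsilon^{-2}t)^{-k}.$$
   Context: $\Lambda_N=[-N,N]\cap\mathbb Z$, $\epsilon=1/N$. Active/passive marks process: for each pair $\{x,x+1\}$, $x\in\mathbb Z$, an independent Poisson process of intensity $\epsilon^{-2}$ of ''marks'', each mark independently ''active'' or ''passive'' with probability $1/2$; law $\mathbf P_\epsilon$. Two stirring particles start at distinct sites $x_1,x_2\in\Lambda_N$; when an active mark appears at a pair $\{x,y\}\subset\Lambda_N$ the contents of $x$ and $y$ are exchanged (passive marks and marks at pairs not contained in $\Lambda_N$ have no effect). $x_i(s)$ is the position of particle $i$ at time $s$. $\tau_{x_1,x_2}$ is the first time $s\ge0$ with $|x_1(s)-x_2(s)|=1$ at which a mark (active or passive) appears at the pair $\{x_1(s),x_2(s)\}$. $N_{x_1,x_2,t}$ is the number of times $s\in[0,t]$ such that $|x_1(s)-x_2(s)|=1$ and a mark (active or passive) appears at time $s$ at the pair $\{x_1(s),x_2(s)\}$. *)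

(* Defs.v *)
From HB Require Import structures.
From mathcomp Require Import all_boot all_order all_algebra.
From mathcomp Require Import all_classical all_reals all_analysis.
Set Implicit Arguments. Unset Strict Implicit. Unset Printing Implicit Defensive.
Import Order.TTheory GRing.Theory Num.Theory.
Local Open Scope classical_set_scope.
Local Open Scope ring_scope.

Section Stirring.
Context {d : measure_display} {T : measurableType d} {R : realType}.

Definition mutually_independent (I : eqType) (P : probability T R)
  (G : I -> set (set T)) : Prop :=
  forall (s : seq I), uniq s ->
  forall A : I -> set T, (forall i, i \in s -> G i (A i)) ->
  P (\bigcap_(i in [set` s]) A i) = (\prod_(i <- s) P (A i))%E.

(* The marks process.  For the pair {x, x+1} (x : int), the k-th mark
   (k = 0,1,2,...) occurs at time E x 0 + ... + E x k, where the
   interarrival times E x k are exponential of rate eps^-2 = N^2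
   (so the mark times form a Poisson process of intensity eps^-2),
   and the mark is active iff B x k = true (probability 1/2).
   All the E x k, B x k are mutually independent. *)
Definition marks_process (N : nat) (P : probability T R)
  (E : int -> nat -> T -> R) (B : int -> nat -> T -> bool) : Prop :=
  [/\ forall x k, measurable_fun setT (E x k),
      forall x k, measurable_fun setT (B x k),
      forall x k (A : set R), measurable A ->
        P (E x k @^-1` A) = exponential_prob ((N%:R) ^+ 2 : R) A,
      forall x k (A : set bool),
        P (B x k @^-1` A) = bernoulli_prob (2^-1 : R) A &
      mutually_independent P
        (fun i : int * nat * bool =>
           let: (x, k, b) := i in
           if b then [set B x k @^-1` A | A in [set: set bool]]
           else [set E x k @^-1` A | A in [set A : set R | measurable A]])].

Definition mark_time (E : int -> nat -> T -> R) (x : int) (k : nat) (w : T) : R :=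
  \sum_(j < k.+1) E x j w.

(* the pairs {x, x+1} contained in Lambda_N = [-N, N] : x = -N, ..., N-1 *)
Definition inner_edges (N : nat) : seq int :=
  [seq (i%:Z - N%:Z)%R | i <- iota 0 (2 * N)].

Definition in_Lambda (N : nat) (x : int) : bool := (- (N%:Z) <= x <= N%:Z)%R.

Definition argmin_seq (s : seq int) (f : int -> R) : int :=
  foldl (fun best e => if f e < f best then e else best) (head 0%R s) (behead s).

(* state: number of marks already used on each pair, positions of the
   two particles *)
Definition state := ((int -> nat) * (int * int))%type.

Definition swap_site (e p : int) : int :=
  if p == e then (e + 1)%R else if p == (e + 1)%R then e else p.

Definition next_edge N E (w : T) (st : state) : int :=
  argmin_seq (inner_edges N) (fun e => mark_time E e (st.1 e) w).

Definition next_time N E (w : T) (st : state) : R :=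
  let e := next_edge N E w st in mark_time E e (st.1 e) w.

Definition step N E (B : int -> nat -> T -> bool) (w : T) (st : state) : state :=
  let e := next_edge N E w st in
  let c := st.1 in
  let c' := fun y => if y == e then (c y).+1 else c y in
  if B e (c e) w then (c', (swap_site e st.2.1, swap_site e st.2.2))
  else (c', st.2).

Definition state_n N E B (x1 x2 : int) (w : T) (n : nat) : state :=
  iter n (step N E B w) (fun _ => 0%N, (x1, x2)).

Definition event_time N E B x1 x2 w n : R :=
  next_time N E w (state_n N E B x1 x2 w n).

Definition collision N E B x1 x2 w n : bool :=
  let st := state_n N E B x1 x2 w n in
  let e := next_edge N E w st in
  (`|st.2.1 - st.2.2| == 1)%R && (Num.min st.2.1 st.2.2 == e).

Definition tau_ge N E B x1 x2 (t : R) : set T :=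
  [set w | forall n, collision N E B x1 x2 w n -> t <= event_time N E B x1 x2 w n].

Definition Ncoll_ge N E B x1 x2 (t r : R) : set T :=
  [set w | exists m : nat,
     r <= (count (fun n => collision N E B x1 x2 w n &&
                            (event_time N E B x1 x2 w n <= t)) (iota 0 m))%:R].

End Stirring.

(* Main.v *)
Require Import Defs.
From HB Require Import structures.
From mathcomp Require Import all_boot all_order all_algebra.
From mathcomp Require Import all_classical all_reals all_analysis.
From mathcomp Require Import measurable_realfun.
From mathcomp Require Import ring lra zify.
Import Order.TTheory GRing.Theory Num.Theory.
Import numFieldNormedType.Exports.
Local Open Scope classical_set_scope.
Local Open Scope ring_scope.

(**
  In the graphical construction only the marks inside the box matter. By the lack of memory of
  the exponential law, the successive pairs rung and mark types are uniform, and the Laplace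
  transform at [th] of the time of the [n]-th mark, restricted to a prescribed history of [n]
  marks, is exactly [jump_weight N th ^+ n]. Every bound is then a sum over a tree of histories,
  controlled by a super- or subharmonic function of the two (ordered) walkers [l < k]; throughout
  [th = 1/t] and [kap ^ 2 = th / N ^ 2 = 1 / (N ^ 2 t)].

  (i) [(1 - kap) ^ (k - l)], replaced by [1] after the first collision, is subharmonic, because
  the reflection at the ends of the box only suppresses moves that lower it. Hence
  [E (exp (- tau / t)) >= 1 - kap], and Markov's inequality for [1 - exp (- tau / t)] concludes.

  (ii) [1 + q ^ (2 - (k - l)) + q ^ (k - N) + q ^ (- l - N)], [q = 1 + kap], remains
  superharmonic when each collision is rewarded by a factor [1 + O(kap)]; this uses [t <= Tmax].
  Stopping at the [m]-th collision gives a probability [O((1 + O(kap)) ^ - m)] that [m]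
  collisions occur before [t], which is [exp (- c (N ^ 2 t) ^ zeta)] for [m = (N^2 t)^(1/2+zeta)].
*)

(** The number of marks before a fixed time is random. Weighting a history by [exp (- clock / t)]
    amounts to observing the system at an independent exponential time of mean [t]; time then costs
    one constant factor per mark, and what remains is a weighted sum over words in pairs and types.
    Independence is given as a product formula for finite families, so the induction that yields
    this factor must also describe every gap and type that the history has not consumed. The
    distance [k - l] alone is not Markov, because of the ends of the box; this is why the test
    functions depend on both positions. The value of [kap] balances discount and diffusion. The four
    moves of two walkers change an exponential profile of ratio close to [1 + kap] or [1 - kap] by
    about [2 * kap ^ 2] times itself, and [1 / jump_weight] is exactly [4 * N + 2 * kap ^ 2], where
    [4 * N] counts the possible marks. On bounded times about [1 / kap] collisions are expected, so
    a reward of order [kap] for each of them keeps the total reward of order one. *)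

(** * Elementary inequalities *)

Lemma ler_of_le_addV (R : realType) (x a b : R) :
  (forall p : nat, (0 < p)%N -> x <= a + b / p%:R) -> x <= a.
Proof.
move=> H; rewrite leNgt; apply/negP => ax.
have d0 : 0 < x - a by rewrite subr_gt0.
have [p pb] : exists p : nat, (`|b| + 1) / (x - a) < p%:R.
  exists (Num.bound ((`|b| + 1) / (x - a))).
  by apply: archi_boundP; rewrite divr_ge0 ?ltW// addr_ge0.
have p0 : 0 < p%:R :> R by apply: le_lt_trans pb; rewrite divr_ge0 ?ltW// addr_ge0.
have := H p; rewrite -(ltr0n R) => /(_ p0); apply/negP; rewrite -ltNge.
rewrite -ltrBrDl ltr_pdivrMr// mulrC -ltr_pdivrMr//.
apply: le_lt_trans pb; rewrite ler_pM2r ?invr_gt0//.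
by rewrite (le_trans (ler_norm b))// lerDl.
Qed.

Lemma expRN_ge (R : realType) (x : R) : 1 - x <= expR (- x).
Proof. exact: expR_ge1Dx. Qed.

Lemma expRN_le (R : realType) (x : R) : 0 <= x -> expR (- x) <= (1 + x)^-1.
Proof.
move=> x0; rewrite expRN lef_pV2 ?posrE ?expR_gt0 ?expR_ge1Dx//.
by rewrite ltr_pwDl.
Qed.

Lemma bernoulli_inequality (R : realType) (x : R) (n : nat) : 0 <= x ->
  1 + x *+ n <= (1 + x) ^+ n.
Proof.
move=> x0; elim: n => [|n IH]; first by rewrite mulr0n addr0 expr0.
rewrite exprSr; apply: le_trans (_ : (1 + x *+ n) * (1 + x) <= _); last first.
  by rewrite ler_wpM2r// addr_ge0.
rewrite mulrDl mul1r mulrDr mulr1 mulrS addrA lerD2l.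
by rewrite lerDl mulr_ge0 ?mulrn_wge0.
Qed.

(** * Measurable sets and integrals of nonnegative real functions *)

Section measurable_sets.
Context {d : measure_display} {T : measurableType d} {R : realType}.

Lemma measurable_bool_set (b : T -> bool) :
  measurable_fun setT b -> measurable [set w | b w].
Proof.
move=> mb; have := mb measurableT [set true] I; rewrite setTI.
by congr measurable; apply/seteqP; split.
Qed.

Lemma measurable_ler_set (f g : T -> R) : measurable_fun setT f ->
  measurable_fun setT g -> measurable [set w | f w <= g w].
Proof. by move=> mf mg; apply: measurable_bool_set; exact: measurable_fun_ler. Qed.

Lemma measurable_ltr_set (f g : T -> R) : measurable_fun setT f ->
  measurable_fun setT g -> measurable [set w | f w < g w].
Proof. by move=> mf mg; apply: measurable_bool_set; exact: measurable_fun_ltr. Qed.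

End measurable_sets.

Lemma integral_EFin_cst {d : measure_display} {T : measurableType d} {R : realType}
    (mu : {measure set T -> \bar R}) (c : R) (A : set T) : measurable A ->
  (\int[mu]_(w in A) c%:E = c%:E * mu A)%E.
Proof. by move=> mA; exact: (integral_cst mu mA c%:E). Qed.

Section nonneg_real_integrals.
Context {d : measure_display} {T : measurableType d} {R : realType}.
Variables (mu : {measure set T -> \bar R}) (F : T -> R).
Hypotheses (mF : measurable_fun setT F) (F0 : forall w, 0 <= F w).

Lemma ge0_integral_EFinU (A B : set T) : measurable A -> measurable B ->
  (forall w, A w -> B w -> False) ->
  (\int[mu]_(w in A `|` B) (F w)%:E =
   \int[mu]_(w in A) (F w)%:E + \int[mu]_(w in B) (F w)%:E)%E.
Proof.
move=> mA mB dAB; rewrite ge0_integral_setU//.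
- by apply/measurable_EFinP; exact: measurable_funTS.
- by move=> w _; rewrite lee_fin.
- by rewrite disj_set2E; apply/eqP/seteqP; split => // w [] /dAB.
Qed.

Lemma ge0_subset_integral_EFin (A B : set T) : measurable A -> measurable B ->
  A `<=` B -> (\int[mu]_(w in A) (F w)%:E <= \int[mu]_(w in B) (F w)%:E)%E.
Proof.
move=> mA mB AB; apply: ge0_subset_integral => //.
- by apply/measurable_EFinP; exact: measurable_funTS.
- by move=> w _; rewrite lee_fin.
Qed.

Lemma ge0_le_integral_EFin (H : T -> R) (A : set T) : measurable A ->
  measurable_fun setT H -> (forall w, A w -> F w <= H w) ->
  (\int[mu]_(w in A) (F w)%:E <= \int[mu]_(w in A) (H w)%:E)%E.
Proof.
move=> mA mH FH; apply: ge0_le_integral => //.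
- by move=> w _; rewrite lee_fin.
- by apply/measurable_EFinP; exact: measurable_funTS.
- by apply/measurable_EFinP; exact: measurable_funTS.
Qed.

Lemma ge0_integral_EFinZl (c : R) (A : set T) : measurable A -> 0 <= c ->
  (\int[mu]_(w in A) (c * F w)%:E = c%:E * \int[mu]_(w in A) (F w)%:E)%E.
Proof.
move=> mA c0; under eq_integral do rewrite EFinM.
rewrite ge0_integralZl ?lee_fin//.
- by apply/measurable_EFinP; exact: measurable_funTS.
- by move=> w _; rewrite lee_fin.
Qed.

End nonneg_real_integrals.

(** * The first clock to ring *)

(* [f] is the overshoot of a clock, [G a] the event that the other overshoots exceed [a] plus
   prescribed amounts, and [Z] the event that the first clock rings first and leaves the others
   these amounts. Only the tails [intW] are known, so the range of [f] is cut into cells of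
   length [dl], which squeezes the integral over [Z] between two geometric sums. *)
Section winning_clock.
Context {d : measure_display} {T : measurableType d} {R : realType}.
Variable mu : {measure set T -> \bar R}.
Variables (D Z : set T) (G : R -> set T) (Y f : T -> R) (lam nu th C : R).
Hypotheses (mD : measurable D) (mZ : measurable Z).
Hypothesis mG : forall a, measurable (G a).
Hypotheses (mY : measurable_fun setT Y) (mf : measurable_fun setT f).
Hypothesis Y0 : forall w, 0 <= Y w.
Hypotheses (lam0 : 0 < lam) (nu0 : 0 <= nu) (th0 : 0 <= th) (C0 : 0 <= C).
(** The two inclusions differ by ties: [argmin_seq] settles equal ringing times by the order of the
    list, so membership in [Z] is guaranteed only when the other clocks ring strictly later, whence
    [f w < b]. *)
Hypothesis ZG : forall w, Z w -> [/\ D w, 0 <= f w & G (f w) w].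
Hypothesis GZ : forall w b, D w -> 0 <= f w -> f w < b -> G b w -> Z w.
Hypothesis G_anti : forall a b w, a <= b -> G b w -> G a w.

(** In the application [Y] is the Laplace weight of the past, [lam] the rate of the clock with
    overshoot [f], and [nu] the total rate of its competitors. *)
Let W a b := D `&` [set w | a <= f w] `&` G b.

Hypothesis intW : forall a b : R, 0 <= a -> 0 <= b ->
  (\int[mu]_(w in W a b) (Y w)%:E = (C * expR (- (lam * a)) * expR (- (nu * b)))%:E)%E.

Let mge (a : R) : measurable [set w | a <= f w].
Proof. exact: measurable_ler_set. Qed.

Let mlt (a : R) : measurable [set w | f w < a].
Proof. exact: measurable_ltr_set. Qed.

Let mW a b : measurable (W a b).
Proof. by apply: measurableI => //; exact: measurableI. Qed.

Let X w := Y w * expR (- (th * f w)).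

Let X0 w : 0 <= X w. Proof. by rewrite mulr_ge0 ?expR_ge0. Qed.

Let mX : measurable_fun setT X.
Proof.
apply: measurable_funM => //; apply: measurableT_comp => //.
by apply: measurableT_comp => //; exact: measurable_funM.
Qed.

Let intWB (a a' b : R) : 0 <= a -> a <= a' -> 0 <= b ->
  (\int[mu]_(w in W a b `\` W a' b) (Y w)%:E =
   (C * (expR (- (lam * a)) - expR (- (lam * a'))) * expR (- (nu * b)))%:E)%E.
Proof.
move=> a0 aa' b0.
have sub : W a' b `<=` W a b.
  by move=> w [[Dw /= fw] Gw]; split => //; split => //=; exact: le_trans fw.
have := intW _ _ a0 b0; rewrite -{1}(setDUK sub) ge0_integral_EFinU//; last 2 first.
- exact: measurableD.
- by move=> w ? [].
rewrite (intW _ _ (le_trans a0 aa') b0) => E.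
have : (C * expR (- (lam * a)) * expR (- (nu * b)))%:E \is a fin_num by [].
rewrite -E fin_numD => /andP[_ Ifin].
move: E; rewrite -(fineK Ifin) -EFinD => -[E]; congr EFin; lra.
Qed.

(** On a cell, [Z] lies between [W a a'] minus [W a' a'] and [W a a] minus [W a' a], and the
    discount lies between its values at the two ends. The bounds differ only by the factor
    [exp (- (nu + th) * (a' - a))], which tends to 1 with the mesh. *)
Let cell (a a' : R) : 0 <= a -> a <= a' ->
  (\int[mu]_(w in Z `&` [set w | (a <= f w < a')%R]) (X w)%:E <=
   (C * (expR (- (lam * a)) - expR (- (lam * a'))) * expR (- ((nu + th) * a)))%:E)%E
  /\ ((C * (expR (- (lam * a)) - expR (- (lam * a'))) * expR (- ((nu + th) * a')))%:E
  <= \int[mu]_(w in Z `&` [set w | (a <= f w < a')%R]) (X w)%:E)%E.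
Proof.
move=> a0 aa'.
have mc : measurable (Z `&` [set w | (a <= f w < a')%R]).
  apply: measurableI => //.
  rewrite (_ : [set w | _] = [set w | a <= f w] `&` [set w | f w < a']).
    exact: measurableI.
  by apply/seteqP; split => w /=; [move/andP | move=> ?; apply/andP].
have a'0 := le_trans a0 aa'.
have K (k c : R) : C * k * expR (- ((nu + th) * c)) = expR (- (th * c)) * (C * k * expR (- (nu * c))).
  by rewrite mulrDl opprD expRD; ring.
have mexp (c : R) : measurable_fun setT (fun w => expR (- (th * c)) * Y w).
  exact: measurable_funM.
split.
- apply: (@le_trans _ _ (\int[mu]_(w in Z `&` [set w | (a <= f w < a')%R])
     (expR (- (th * a)) * Y w)%:E)%E).
    apply: ge0_le_integral_EFin => //.
    move=> w [_ /= /andP[af _]]; rewrite /X mulrC ler_wpM2r//.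
    by rewrite ler_expR lerN2 ler_wpM2l.
  rewrite ge0_integral_EFinZl ?expR_ge0// K EFinM lee_pmul2l ?fin_numE ?lte_fin ?expR_gt0//.
  rewrite -(intWB _ _ _ a0 aa' a0).
  apply: ge0_subset_integral_EFin => //; first exact: measurableD.
  move=> w [/ZG[Dw f0 Gw] /= /andP[af fa']]; split.
    by split; [split|exact: G_anti Gw].
  by move=> [[_ /=]]; rewrite leNgt fa'.
- apply: (@le_trans _ _ (\int[mu]_(w in Z `&` [set w | (a <= f w < a')%R])
     (expR (- (th * a')) * Y w)%:E)%E); last first.
    apply: ge0_le_integral_EFin => //.
      by move=> w; rewrite mulr_ge0 ?expR_ge0.
    move=> w [_ /= /andP[af fa]]; rewrite /X mulrC ler_wpM2l//.
    by rewrite ler_expR lerN2 ler_wpM2l// ltW.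
  rewrite ge0_integral_EFinZl ?expR_ge0// K EFinM lee_pmul2l ?fin_numE ?lte_fin ?expR_gt0//.
  rewrite -(intWB _ _ _ a0 aa' a'0).
  apply: ge0_subset_integral_EFin => //; first exact: measurableD.
  move=> w [[[Dw /= af] Gw] NW].
  have fa' : f w < a'.
    by rewrite ltNge; apply/negP => fa'; apply: NW; split.
  split; last by apply/andP.
  by apply: GZ fa' Gw => //; exact: le_trans af.
Qed.

Let x dl := expR (- ((lam + nu + th) * dl)).
Let J := fine (\int[mu]_(w in Z) (X w)%:E)%E.

Let grid (dl : R) (K : nat) : 0 <= dl ->
  (\int[mu]_(w in Z `&` [set w | (f w < K%:R * dl)%R]) (X w)%:E <=
   (C * (1 - expR (- (lam * dl))) * \sum_(j < K) x dl ^+ j)%:E)%E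
  /\ ((C * (1 - expR (- (lam * dl))) * expR (- ((nu + th) * dl)) * \sum_(j < K) x dl ^+ j)%:E
  <= \int[mu]_(w in Z `&` [set w | (f w < K%:R * dl)%R]) (X w)%:E)%E.
Proof.
move=> dl0; elim: K => [|K [IH1 IH2]].
  rewrite !big_ord0 !mulr0 mul0r (_ : _ `&` _ = set0) ?integral_set0//.
  by apply/seteqP; split => // w [/ZG[_ f0 _] /=]; rewrite ltNge f0.
set a := K%:R * dl; set a' := K.+1%:R * dl.
have a0 : 0 <= a by rewrite mulr_ge0.
have aa' : a <= a' by rewrite ler_wpM2r// ler_nat.
have E : Z `&` [set w | (f w < a')%R] =
    (Z `&` [set w | (f w < a)%R]) `|` (Z `&` [set w | (a <= f w < a')%R]).
  apply/seteqP; split => w /=.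
    move=> [Zw fa']; case: (ltP (f w) a) => fa; [left|right]; split=> //.
  by move=> [[Zw fa]|[Zw /andP[_ fa]]]; split => //; exact: lt_le_trans aa'.
have mc : measurable (Z `&` [set w | (a <= f w < a')%R]).
  apply: measurableI => //.
  rewrite (_ : [set w | _] = [set w | a <= f w] `&` [set w | f w < a']).
    exact: measurableI.
  by apply/seteqP; split => w /=; [move/andP | move=> ?; apply/andP].
rewrite E ge0_integral_EFinU//; last 2 first.
- exact: measurableI.
- move=> w /= [_ f1] [_ /andP[f2 _]].
  by move: f1; rewrite ltNge f2.
have [c1 c2] := cell _ _ a0 aa'.
have P1 : C * (expR (- (lam * a)) - expR (- (lam * a'))) * expR (- ((nu + th) * a))
    = C * (1 - expR (- (lam * dl))) * x dl ^+ K.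
  rewrite /x -expRM_natl.
  have -> : expR (- (lam * a')) = expR (- (lam * a)) * expR (- (lam * dl)).
    by rewrite -expRD; congr expR; rewrite /a' /a -natr1; ring.
  have -> : K%:R * - ((lam + nu + th) * dl) = - (lam * a) - (nu + th) * a.
    by rewrite /a; ring.
  by rewrite expRD; ring.
have P2 : C * (expR (- (lam * a)) - expR (- (lam * a'))) * expR (- ((nu + th) * a'))
    = C * (1 - expR (- (lam * dl))) * expR (- ((nu + th) * dl)) * x dl ^+ K.
  have -> : expR (- ((nu + th) * a')) = expR (- ((nu + th) * a)) * expR (- ((nu + th) * dl)).
    by rewrite -expRD; congr expR; rewrite /a' /a -natr1; ring.
  by rewrite mulrA P1; ring.
rewrite !big_ord_recr/=; set S := (\sum_(i < K) _) in IH1 IH2 *.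
rewrite 2!(mulrDr _ S) !EFinD -P1 -P2.
by split; apply: leeD.
Qed.

Let intZ_fin : (\int[mu]_(w in Z) (X w)%:E)%E \is a fin_num.
Proof.
rewrite ge0_fin_numE; last by apply: integral_ge0 => w _; rewrite lee_fin.
suff: (\int[mu]_(w in Z) (X w)%:E <= \int[mu]_(w in W 0%R 0%R) (Y w)%:E)%E.
  by move/le_lt_trans; apply; rewrite intW// ltry.
apply: (@le_trans _ _ (\int[mu]_(w in Z) (Y w)%:E)%E).
  apply: ge0_le_integral_EFin => //.
  move=> w /ZG[_ f0 _]; rewrite /X ler_piMr//.
    by rewrite -expR0 ler_expR oppr_le0 mulr_ge0.
apply: ge0_subset_integral_EFin => //.
move=> w /ZG[Dw f0 Gw]; split; first by split.
exact: G_anti Gw.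
Qed.

Let gridR (dl : R) (K : nat) : 0 <= dl ->
  J <= C * (1 - expR (- (lam * dl))) * \sum_(j < K) x dl ^+ j
       + C * expR (- (lam * (K%:R * dl))) /\
  C * (1 - expR (- (lam * dl))) * expR (- ((nu + th) * dl)) * \sum_(j < K) x dl ^+ j <= J.
Proof.
move=> dl0; have [g1 g2] := grid _ K dl0.
set a := K%:R * dl; have a0 : 0 <= a by rewrite mulr_ge0.
have EZ : Z = (Z `&` [set w | (f w < a)%R]) `|` (Z `&` [set w | (a <= f w)%R]).
  apply/seteqP; split => w /=; last by case=> -[].
  by move=> Zw; case: (ltP (f w) a) => fa; [left|right].
rewrite -!lee_fin fineK//; split; last first.
  apply: le_trans g2 _; apply: ge0_subset_integral_EFin => //; first exact: measurableI.
rewrite [in leLHS]EZ ge0_integral_EFinU//; last 3 first.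
- exact: measurableI.
- exact: measurableI.
- move=> w /= [_ f1] [_ f2].
  by move: f1; rewrite ltNge f2.
rewrite EFinD; apply: leeD => //.
have -> : C * expR (- (lam * a)) = C * expR (- (lam * a)) * expR (- (nu * 0)).
  by rewrite mulr0 oppr0 expR0 mulr1.
rewrite -intW//.
apply: (@le_trans _ _ (\int[mu]_(w in Z `&` [set w | (a <= f w)%R]) (Y w)%:E)%E).
  apply: ge0_le_integral_EFin => //; first exact: measurableI.
  move=> w [/ZG[_ f0 _] _]; rewrite /X ler_piMr//.
    by rewrite -expR0 ler_expR oppr_le0 mulr_ge0.
apply: ge0_subset_integral_EFin => //; first exact: measurableI.
move=> w [/ZG[Dw f0 Gw] fa]; split; first by split.
exact: G_anti Gw.
Qed.

Lemma winning_clock_laplace :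
  (\int[mu]_(w in Z) (Y w * expR (- (th * f w)))%:E
   = (C * (lam / (lam + nu + th)))%:E)%E.
Proof.
have L0 : 0 < lam + nu + th by rewrite -addrA ltr_pwDl// addr_ge0.
rewrite -/X -(fineK intZ_fin) -/J; congr EFin.
have J0 : 0 <= J by apply: fine_ge0; apply: integral_ge0 => w _; rewrite lee_fin.
pose L := lam + nu + th.
have geo (dl : R) K : (\sum_(j < K) x dl ^+ j) * (1 - x dl) = 1 - x dl ^+ K.
  by rewrite mulrC -[RHS]opprB subrX1 -mulNr opprB.
suff [h1 h2] : J * L <= C * lam /\ C * lam <= J * L.
  have : J * L = C * lam by apply/eqP; rewrite eq_le h1 h2.
  by move=> E; rewrite mulrA -E mulfK// gt_eqF.
have eN (y : R) : 0 <= y -> expR (- y) <= 1.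
  by move=> y0; rewrite -expR0 ler_expR oppr_le0.
have LE : L = lam + nu + th by [].
have bnd (p K : nat) : (0 < p)%N ->
   J * (1 - x p%:R^-1) <= C * (1 - expR (- (lam * p%:R^-1))) + C * expR (- (lam * (K%:R * p%:R^-1)))
   /\ C * (1 - expR (- (lam * p%:R^-1))) * expR (- ((nu + th) * p%:R^-1)) * (1 - x p%:R^-1 ^+ K)
     <= J * (1 - x p%:R^-1).
  move=> p0; set dl := p%:R^-1.
  have d0 : 0 < dl by rewrite invr_gt0 ltr0n.
  have [g1 g2] := gridR _ K (ltW d0).
  have x1 : 0 <= 1 - x dl by rewrite subr_ge0; apply: eN; rewrite mulr_ge0 ?ltW.
  have xle : 1 - x dl <= 1 by rewrite lerBlDr lerDl expR_ge0.
  have e1 : 0 <= 1 - expR (- (lam * dl)) by rewrite subr_ge0; apply: eN; rewrite mulr_ge0 ?ltW.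
  split.
    have := ler_wpM2r x1 g1; rewrite mulrDl -[X in _ <= X + _]mulrA geo.
    move/le_trans; apply; apply: lerD.
      by rewrite ler_piMr ?mulr_ge0// lerBlDr lerDl exprn_ge0// expR_ge0.
    by rewrite ler_piMr ?mulr_ge0 ?expR_ge0.
  by have := ler_wpM2r x1 g2; rewrite -[X in X <= _]mulrA geo.
split.
- apply: (@ler_of_le_addV _ _ _ (C * lam * L + C / lam + C * L / lam)) => p p0.
  (* Mesh [1 / p] and range [p ^ 2]: the inequality is about to be divided by the mesh, so the tail
     must be [o (1 / p)]. As it is only estimated by [exp (- y) <= 1 / (1 + y)], the range has to be
     quadratic in [p]. *)
  have [b1 _] := bnd p (p ^ 3)%N p0; move: b1; rewrite natrX.
  have P0 : 0 < p%:R :> R by rewrite ltr0n.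
  have P1 : 1 <= p%:R :> R by rewrite ler1n.
  set q : R := p%:R^-1.
  have q0 : 0 < q by rewrite invr_gt0.
  have q1 : q <= 1 by rewrite invf_le1.
  have pq : p%:R ^+ 3 * q = p%:R ^+ 2 by rewrite /q exprS mulrAC mulfV ?mul1r// gt_eqF.
  rewrite pq => b1.
  have e1 := expRN_ge _ (lam * q).
  have y0 : 0 < lam * p%:R ^+ 2 by rewrite mulr_gt0// exprn_gt0.
  have e2 : expR (- (lam * p%:R ^+ 2)) <= q ^+ 2 / lam.
    apply: le_trans (expRN_le _ _ (ltW y0)) _.
    rewrite /q exprVn -invfM lef_pV2 ?posrE ?mulr_gt0 ?exprn_gt0//; last by rewrite ltr_wpDl.
    by rewrite mulrC lerDr.
  have e3 : x q <= (1 + L * q)^-1.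
    by rewrite /x -LE; apply: expRN_le; rewrite mulr_ge0 ?ltW.
  have Lq0 : 0 < 1 + L * q by rewrite ltr_pwDl// mulr_ge0 ?ltW.
  have b2 : J * (L * q) <= (C * (lam * q) + C * (q ^+ 2 / lam)) * (1 + L * q).
    have i1 : (1 - (1 + L * q)^-1) * (1 + L * q) = L * q.
      by rewrite mulrBl mulVf ?gt_eqF//; ring.
    rewrite -[in leLHS]i1 (mulrA J) ler_wpM2r ?(ltW Lq0)//.
    apply: (@le_trans _ _ (J * (1 - x q))); first by rewrite ler_wpM2l// lerD2l lerN2.
    apply: le_trans b1 _; apply: lerD; last by rewrite ler_wpM2l.
    by rewrite ler_wpM2l// lerBlDr addrC -lerBlDr.
  have b3 : J * L <= (C * lam + C * (q / lam)) * (1 + L * q).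
    rewrite -(ler_pM2r q0) -(mulrA J); apply: le_trans b2 _.
    by rewrite le_eqVlt; apply/orP; left; apply/eqP; ring.
  apply: le_trans b3 _; rewrite -/q.
  have c0 : 0 <= C * L / lam * q * (1 - q).
    by rewrite !mulr_ge0 ?invr_ge0 ?subr_ge0// ltW.
  set i := lam^-1 in c0 *.
  rewrite (_ : (C * lam + C * (q * i)) * (1 + L * q) =
     C * lam + (C * lam * L + C * i + C * L * i) * q - C * L * i * q * (1 - q)); last by ring.
  by rewrite lerBlDr lerDl.
- apply: (@ler_of_le_addV _ _ _ (C * lam * (lam + L + L^-1))) => p p0.
  (* Here the tail multiplies the main term, so a relative error [O (1 / p)], hence the range [p],
     is enough. *)
  have [_ b1] := bnd p (p ^ 2)%N p0; move: b1.
  have P0 : 0 < p%:R :> R by rewrite ltr0n.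
  set q : R := p%:R^-1.
  have q0 : 0 < q by rewrite invr_gt0.
  rewrite /x -expRM_natl natrX.
  have -> : p%:R ^+ 2 * - ((lam + nu + th) * q) = - (L * p%:R).
    by rewrite mulrN mulrCA /q exprS expr1 -mulrA mulfV ?mulr1// gt_eqF.
  set a := 1 - expR _; set b := expR _; set c := expR _; set e := expR _ => b1.
  have ha : lam * q * (1 - lam * q) <= a.
    have := expRN_le _ _ (ltW (mulr_gt0 lam0 q0)).
    have l0 : 0 < 1 + lam * q by rewrite ltr_pwDl// mulr_ge0 ?ltW.
    rewrite -(ler_pM2r l0) mulVf ?gt_eqF// => h.
    rewrite -(ler_pM2r l0) /a.
    have : 0 <= (lam * q) ^+ 3 by rewrite exprn_ge0// mulr_ge0 ?ltW.
    set z := expR _ in h *; set y := lam * q in h *; move=> y3.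
    by rewrite (_ : y * (1 - y) * (1 + y) = y - y ^+ 3); [lra|ring].
  have ha' : a <= lam * q by have := expRN_ge _ (lam * q); rewrite /a; lra.
  have a0 : 0 <= a by rewrite subr_ge0; apply: eN; rewrite mulr_ge0 ?ltW.
  have hb : 1 - L * q <= b.
    apply: le_trans (expRN_ge _ _); rewrite lerD2l lerN2 ler_wpM2r ?(ltW q0)// LE.
    by rewrite -addrA lerDr ltW.
  have hb' : b <= 1 by apply: eN; rewrite mulr_ge0 ?addr_ge0 ?(ltW q0).
  have hc : c <= L^-1 * q.
    have Lp : 0 < L * p%:R by rewrite mulr_gt0.
    apply: le_trans (expRN_le _ _ (ltW Lp)) _.
    by rewrite /q -invfM lef_pV2 ?posrE// ?lerDr// ltr_wpDl.
  have hc' : 0 <= c by exact: expR_ge0.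
  have he : 1 - e <= L * q by have := expRN_ge _ (L * q); rewrite -/e; lra.
  have b2 : C * (lam * q * (1 - lam * q) - lam * q * (L * q) - lam * q * (L^-1 * q)) <= J * (L * q).
    apply: le_trans (ler_wpM2l J0 he); apply: le_trans b1; rewrite -!mulrA ler_wpM2l//.
    have t1 : 0 <= (1 - b) * c * a by rewrite !mulr_ge0// subr_ge0.
    have t2 : a * (1 - b) <= lam * q * (L * q).
      by apply: ler_pM => //; rewrite ?subr_ge0//; lra.
    have t3 : a * c <= lam * q * (L^-1 * q) by apply: ler_pM.
    rewrite (_ : a * (b * (1 - c)) = a - a * (1 - b) - a * c + (1 - b) * c * a); last by ring.
    by rewrite !mulrA in ha t2 t3 *; lra.
  have b3 : C * (lam * (1 - lam * q) - lam * (L * q) - lam * (L^-1 * q)) <= J * L.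
    rewrite -(ler_pM2r q0); apply: le_trans (_ : J * (L * q) <= _); last by rewrite mulrA.
    by apply: le_trans b2; rewrite le_eqVlt; apply/orP; left; apply/eqP; ring.
  rewrite -lerBlDr; apply: le_trans b3.
  by rewrite le_eqVlt; apply/orP; left; apply/eqP; rewrite -/q; ring.
Qed.

End winning_clock.

(** * Exponential tails, and measurability under quantifiers *)

Lemma exponential_prob_tail (R : realType) (lam v : R) : 0 < lam -> 0 <= v ->
  exponential_prob lam `[v, +oo[%classic = (expR (- (lam * v)))%:E.
Proof.
move=> lam0 v0; rewrite /exponential_prob.
have cexp : continuous (fun z : R^o => expR (- lam * z)).
  move=> z; apply: continuous_comp; last exact: continuous_expR.
  by apply: continuousM => //; apply: (@continuousN _ R^o); exact: cst_continuous.
rewrite (@ge0_continuous_FTC2y _ _ (fun x => - (expR (- lam * x))) _ 0)//.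
- by rewrite sub0e -EFinN opprK mulNr.
- by move=> x _; apply: exponential_pdf_ge0; exact: ltW.
- apply: (@continuous_subspaceW R^o _ _ [set` `[0, +oo[%R]); last first.
    exact: within_continuous_exponential_pdf.
  by move=> x /=; rewrite !in_itv/= !andbT; exact: le_trans.
- rewrite -oppr0; apply: cvgN.
  rewrite (_ : (fun x => expR (- lam * x)) =
               (fun z => expR (- z)) \o (fun z => lam * z)); last first.
    by apply: eq_fun => x; rewrite mulNr.
  apply: (@cvg_comp _ _ _ _ _ _ (pinfty_nbhs R)); last exact: cvgr_expR.
  exact: gt0_cvgMry.
- by apply: cvgN; apply/cvg_at_right_filter; exact: cexp.
- move=> x; rewrite in_itv/= andbT => vx; apply: derive1_exponential_pdf.
  by rewrite in_itv/= andbT (le_lt_trans v0).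
Qed.

Section measurable_quantifiers.
Context {d : measure_display} {T : measurableType d}.

Lemma measurable_forall {J : countType} (A : J -> T -> Prop) :
  (forall i, measurable [set w | A i w]) -> measurable [set w | forall i, A i w].
Proof.
move=> mA; have -> : [set w | forall i, A i w] = ~` \bigcup_i (~` [set w | A i w]).
  rewrite setC_bigcup; apply/seteqP; split => w /=.
    by move=> h i _ /=; apply; exact: h.
  by move=> h i; have := h i I => /= /contrapT.
apply: measurableC; apply: countable_bigcupT_measurable => // i.
exact: measurableC.
Qed.

Lemma measurable_imply (Q : Prop) (A : T -> Prop) :
  measurable [set w | A w] -> measurable [set w | Q -> A w].
Proof.
move=> mA; have [q|nq] := pselect Q.
  by rewrite (_ : [set w | Q -> A w] = [set w | A w])//; apply/seteqP; split=> w /=; tauto.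
by rewrite (_ : [set w | Q -> A w] = setT)//; apply/seteqP; split=> w /=; tauto.
Qed.

Lemma measurable_and (A A' : T -> Prop) : measurable [set w | A w] ->
  measurable [set w | A' w] -> measurable [set w | A w /\ A' w].
Proof. by move=> mA mA'; exact: measurableI mA mA'. Qed.

End measurable_quantifiers.

(** * Histories of the marks *)

Section argmin.
Context {R : realType}.
Implicit Types (f : int -> R) (s : seq int).

Let keep f (best e : int) := if f e < f best then e else best.

Lemma foldl_argmin_in f x s : foldl (keep f) x s \in x :: s.
Proof.
elim: s x => [|a s IH] x /=; first by rewrite mem_head.
have := IH (keep f x a); rewrite !inE /keep => /orP[/eqP->|->]; last by rewrite !orbT.
by case: ifP; rewrite eqxx ?orbT.
Qed.

Lemma foldl_argmin_le f x s y : y \in x :: s -> f (foldl (keep f) x s) <= f y.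
Proof.
elim: s x y => [|a s IH] x y /=; first by rewrite inE => /eqP->.
rewrite !inE => /or3P[/eqP->|/eqP->|ys].
- apply: le_trans (IH (keep f x a) (keep f x a) _) _; first by rewrite mem_head.
  by rewrite /keep; case: ltP => // /ltW.
- apply: le_trans (IH (keep f x a) (keep f x a) _) _; first by rewrite mem_head.
  by rewrite /keep; case: ltP.
- by apply: IH; rewrite inE ys orbT.
Qed.

Lemma argmin_seq_in s f : s != [::] -> argmin_seq s f \in s.
Proof. by case: s => // x s _; exact: foldl_argmin_in. Qed.

Lemma argmin_seq_le s f y : y \in s -> f (argmin_seq s f) <= f y.
Proof. by case: s => // x s; exact: foldl_argmin_le. Qed.

Lemma argmin_seqP s f e : e \in s -> (forall g, g \in s -> g != e -> f e < f g) ->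
  argmin_seq s f = e.
Proof.
move=> es ef; apply/eqP; apply: contraT => ne.
have sn0 : s != [::] by case: s es {ef ne}.
by have := ef _ (argmin_seq_in _ f sn0) ne; rewrite ltNge argmin_seq_le.
Qed.

Lemma measurable_argmin {d : measure_display} {T : measurableType d}
    (f : T -> int -> R) s e : (forall g, measurable_fun setT (f ^~ g)) ->
  measurable [set w | argmin_seq s (f w) = e].
Proof.
move=> mf; rewrite /argmin_seq; move: (behead s) (head _ s) => {}s x.
elim: s x => [|a s IH] x /=.
  have [->|ne] := pselect (x = e).
    by rewrite (_ : [set w | _] = setT)//; apply/seteqP; split.
  by rewrite (_ : [set w | _] = set0)//; apply/seteqP; split.
rewrite (_ : [set w | _] =
  ([set w | f w a < f w x] `&` [set w | foldl (keep (f w)) a s = e]) `|`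
  ([set w | f w x <= f w a] `&` [set w | foldl (keep (f w)) x s = e])).
  apply: measurableU; apply: measurableI; [exact: measurable_ltr_set|exact: IH|
    exact: measurable_ler_set|exact: IH].
apply/seteqP; split => w /=; rewrite /keep.
  by case: ltP => h E; [left|right].
by case: ltP => h [[]|[]].
Qed.

End argmin.

Section histories.
Context {d : measure_display} {T : measurableType d} {R : realType}.
Variables (N : nat) (E : int -> nat -> T -> R) (B : int -> nat -> T -> bool).
Variables (x1 x2 : int).

(* A history records, most recent first, the pair and the type of each mark. *)
Definition dstep (st : state) (p : int * bool) : state :=
  (fun y => if y == p.1 then (st.1 y).+1 else st.1 y,
   if p.2 then (swap_site p.1 st.2.1, swap_site p.1 st.2.2) else st.2).

Fixpoint hstate (h : seq (int * bool)) : state :=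
  if h is p :: h' then dstep (hstate h') p else (fun _ => 0%N, (x1, x2)).

Lemma stepE w st : let e := next_edge N E w st in
  step N E B w st = dstep st (e, B e (st.1 e) w).
Proof. by rewrite /step /dstep /=; case: ifP. Qed.

Fixpoint hist_of (w : T) (n : nat) : seq (int * bool) :=
  if n is n'.+1 then
    let st := hstate (hist_of w n') in
    let e := next_edge N E w st in (e, B e (st.1 e) w) :: hist_of w n'
  else [::].

Lemma size_hist_of w n : size (hist_of w n) = n.
Proof. by elim: n => //= n ->. Qed.

Lemma state_nE w n : state_n N E B x1 x2 w n = hstate (hist_of w n).
Proof.
elim: n => [//|n IH].
by rewrite /state_n iterS -/(state_n N E B x1 x2 w n) IH stepE.
Qed.

(** The time of the latest mark. Its index is the counter read before that mark, since marks are
    numbered from 0; the empty history has the starting time 0. *)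
Definition clock (h : seq (int * bool)) (w : T) : R :=
  if h is p :: h' then mark_time E p.1 ((hstate h').1 p.1) w else 0.

Lemma event_timeE w n : event_time N E B x1 x2 w n = clock (hist_of w n.+1) w.
Proof. by rewrite /event_time /next_time /= state_nE. Qed.

Definition hcoll (h : seq (int * bool)) : bool :=
  if h is p :: h' then let x := (hstate h').2 in
    (`|x.1 - x.2| == 1)%R && (Num.min x.1 x.2 == p.1) else false.

Lemma collisionE w n : collision N E B x1 x2 w n = hcoll (hist_of w n.+1).
Proof. by rewrite /collision /= state_nE. Qed.

Fixpoint ncoll (h : seq (int * bool)) : nat :=
  if h is p :: h' then (hcoll h + ncoll h')%N else 0%N.

Definition Hist (h : seq (int * bool)) : set T := [set w | hist_of w (size h) = h].

Definition moves : seq (int * bool) := [seq (e, b) | e <- inner_edges N, b <- [:: true; false]].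

Fixpoint hists (n : nat) : seq (seq (int * bool)) :=
  if n is n'.+1 then [seq p :: h | h <- hists n', p <- moves] else [:: [::]].

Lemma big_histsS (V : nmodType) (F : seq (int * bool) -> V) n :
  \sum_(h <- hists n.+1) F h =
  \sum_(h <- hists n) \sum_(e <- inner_edges N) (F ((e, true) :: h) + F ((e, false) :: h)).
Proof.
rewrite /= big_allpairs_dep; apply: eq_bigr => h _.
rewrite big_allpairs_dep; apply: eq_bigr => e _.
by rewrite big_cons big_seq1.
Qed.

Lemma mem_histsS n p h : (p :: h \in hists n.+1) = (p.1 \in inner_edges N) && (h \in hists n).
Proof.
case: p => e b /=; apply/allpairsP/andP => [[[h' p] /= [h'n /allpairsP[[e' b'] /= [e's _ ->]] [-> _ ->]]]//|[es hn]].
exists (h, (e, b)); split=> //=; apply/allpairsP; exists (e, b); split=> //=.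
by case: b; rewrite !inE ?orbT.
Qed.

Lemma size_hists n h : h \in hists n -> size h = n.
Proof.
elim: n h => [|n IH] h; first by rewrite inE => /eqP->.
by case: h => [|p h]; [move/allpairsP => -[? []]|rewrite mem_histsS => /andP[_ /IH /= ->]].
Qed.

Lemma mem_hists n h : h \in hists n -> forall p, p \in h -> p.1 \in inner_edges N.
Proof.
elim: n h => [|n IH] h; first by rewrite inE => /eqP->.
case: h => [|p h]; first by move=> _ p; rewrite in_nil.
rewrite mem_histsS => /andP[ps /IH hs] q; rewrite inE => /orP[/eqP->//|]; exact: hs.
Qed.

Lemma size_inner_edges : size (inner_edges N) = (2 * N)%N.
Proof. by rewrite size_map size_iota. Qed.

Lemma inner_edges_uniq : uniq (inner_edges N).
Proof. by rewrite map_inj_uniq ?iota_uniq// => i j; lia. Qed.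

Lemma mem_inner_edges e : (e \in inner_edges N) = ((- N%:Z <= e) && (e < N%:Z)).
Proof.
apply/mapP/andP => [[i]|[e1 e2]]; first by rewrite mem_iota => h ->; lia.
by exists (absz (e + N%:Z)); [rewrite mem_iota|]; lia.
Qed.

Hypothesis N0 : (0 < N)%N.

Lemma next_edge_in w st : next_edge N E w st \in inner_edges N.
Proof. by apply: argmin_seq_in; rewrite -size_eq0 size_inner_edges; lia. Qed.

Lemma hist_of_in w n : hist_of w n \in hists n.
Proof.
elim: n => [|n IH]; first by rewrite inE.
by rewrite [hist_of _ _]/= mem_histsS IH next_edge_in.
Qed.

Lemma HistS p h : Hist (p :: h) =
  Hist h `&` [set w | next_edge N E w (hstate h) = p.1]
         `&` [set w | B p.1 ((hstate h).1 p.1) w = p.2].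
Proof.
case: p => e b; rewrite /Hist /=; apply/seteqP; split => w /=.
  by move=> [E1 E2 E3]; rewrite E3 in E1 E2; rewrite E1 in E2.
by move=> [[-> -> ->]].
Qed.

Lemma Hist_hist_of w n : Hist (hist_of w n) w.
Proof. by rewrite /Hist /= size_hist_of. Qed.

Hypothesis mE : forall x k, measurable_fun setT (E x k).
Hypothesis mB : forall x k, measurable_fun setT (B x k).

Lemma measurable_mark_time x k : measurable_fun setT (mark_time E x k).
Proof. by apply: measurable_sum => i; exact: mE. Qed.

Lemma measurable_clock h : measurable_fun setT (clock h).
Proof. by case: h => [|p h] /=; [exact: measurable_cst|exact: measurable_mark_time]. Qed.

Lemma measurable_B x k (A : set bool) : measurable [set w | A (B x k w)].
Proof. by have := mB x k measurableT A I; rewrite setTI. Qed.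

Lemma measurable_next_edge st e : measurable [set w | next_edge N E w st = e].
Proof.
apply: (@measurable_argmin _ _ _ (fun w e => mark_time E e (st.1 e) w)) => g.
exact: measurable_mark_time.
Qed.

Lemma measurable_Hist h : measurable (Hist h).
Proof.
elim: h => [|p h IH].
  by rewrite (_ : Hist _ = setT)//; apply/seteqP; split.
rewrite HistS; apply: measurableI; first apply: measurableI => //.
  exact: measurable_next_edge.
exact: (measurable_B _ _ [set p.2]).
Qed.

(** A history of length [n] takes finitely many values, so an event that is measurable once the
    history is frozen is a finite union of measurable pieces. *)
Lemma measurable_by_hist n (Q : T -> Prop) (Qh : seq (int * bool) -> T -> Prop) :
  (forall h, measurable [set w | Qh h w]) -> (forall w, Q w <-> Qh (hist_of w n) w) ->
  measurable [set w | Q w].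
Proof.
move=> mQ QE.
rewrite (_ : [set w | Q w] = \big[setU/set0]_(h <- hists n) (Hist h `&` [set w | Qh h w])).
  by apply: bigsetU_measurable => h _; apply: measurableI => //; exact: measurable_Hist.
rewrite -bigcup_seq; apply/seteqP; split => w /=.
  move=> /QE q; exists (hist_of w n) => /=; first exact: hist_of_in.
  by split => //; rewrite /Hist /= size_hist_of.
move=> [h /= hn [hw q]]; apply/QE; move: hw; rewrite /Hist /= (size_hists _ _ hn).
by move=> ->.
Qed.

End histories.

(** * Lack of memory *)

(* The total rate of the [2N] clocks is [2N lam], [lam = N^2]: a given pair rings first, and
   carries a given type, with probability [1/(4N)], and the Laplace transform at [th] of the
   waiting time is [2N lam / (2N lam + th)]. *)
Definition jump_weight (R : realType) (N : nat) (th : R) : R :=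
  N%:R ^+ 2 / (2 * ((2 * N)%:R * N%:R ^+ 2 + th)).
Arguments jump_weight {R} N th.

Section memoryless.
Context {d : measure_display} {T : measurableType d} {R : realType}.
Variables (N : nat) (P : probability T R).
Variables (E : int -> nat -> T -> R) (B : int -> nat -> T -> bool).
Variables (x1 x2 : int).
Hypotheses (N0 : (0 < N)%N) (MP : marks_process N P E B).

Let lam : R := N%:R ^+ 2.
Let s := inner_edges N.
Local Notation cnt h := (hstate x1 x2 h).1.

Let mE x k : measurable_fun setT (E x k). Proof. by case: MP => + _ _ _ _; apply. Qed.
Let mB x k : measurable_fun setT (B x k). Proof. by case: MP => _ + _ _ _; apply. Qed.
Let lam0 : 0 < lam. Proof. by rewrite exprn_gt0// ltr0n. Qed.

Lemma prob_E_ge x k (v : R) : 0 <= v ->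
  P (E x k @^-1` `[v, +oo[%classic) = (expR (- (lam * v)))%:E.
Proof. by move=> v0; case: MP => _ _ -> // _ _; rewrite exponential_prob_tail. Qed.

Definition pcoin (A : set bool) : R := fine (bernoulli_prob (2^-1 : R) A).

Let pcoinE A : bernoulli_prob (2^-1 : R) A
  = (2^-1 * (true \in A)%:R + 2^-1 * (false \in A)%:R)%:E.
Proof.
rewrite bernoulli_probE; last by apply/andP; split; lra.
have -> : unstable.onem (2^-1 : R) = 2^-1 by rewrite /unstable.onem; lra.
rewrite !diracE EFinD !EFinM.
by case: (_ \in A); case: (_ \in A).
Qed.

Lemma pcoin1 b : pcoin [set b] = 2^-1.
Proof.
rewrite /pcoin pcoinE /=.
have -> : (true \in [set b]) = b by case: b; [rewrite mem_set | rewrite memNset].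
have -> : (false \in [set b]) = ~~ b by case: b; [rewrite memNset | rewrite mem_set].
by case: b => /=; lra.
Qed.

Lemma pcoinT : pcoin setT = 1.
Proof. by rewrite /pcoin pcoinE !mem_set//=; lra. Qed.

Lemma prob_B x k (A : set bool) : P (B x k @^-1` A) = (pcoin A)%:E.
Proof.
by case: MP => _ _ _ -> _; rewrite /pcoin pcoinE.
Qed.

(** Only the laws of the gaps are prescribed, so they are nonnegative almost surely and not
    everywhere. The successive ringing times are ordered on this event, which has full measure. *)
Definition nonneg_gaps : set T := [set w | forall x k, 0 <= E x k w].

Lemma measurable_nonneg_gaps : measurable nonneg_gaps.
Proof.
apply: measurable_forall => x; apply: measurable_forall => k.
exact: measurable_ler_set.
Qed.

Lemma prob_nonneg_gapsI (A : set T) : measurable A -> P (nonneg_gaps `&` A) = P A.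
Proof.
move=> mA; have mO := measurable_nonneg_gaps.
suff : P (~` nonneg_gaps) = 0%E.
  move=> O0; rewrite setIC [RHS](@measureDI _ _ _ P A nonneg_gaps)//.
  rewrite [X in (X + _)%E](_ : _ = 0%E) ?add0e//; apply/eqP.
  rewrite eq_le measure_ge0 andbT -O0; apply: le_measure; rewrite ?inE//.
  - exact: measurableD.
  - exact: measurableC.
apply: (measure_negligible (measurableC mO)).
pose F n : set T := if @unpickle (int * nat)%type n is Some (x, k)
  then [set w | E x k w < 0] else set0.
apply: (@negligibleS _ _ _ _ (\bigcup_n F n)).
  move=> w /= /existsNP[x /existsNP[k /negP]]; rewrite -ltNge => Ew.
  by exists (pickle (x, k)); [|rewrite /F pickleK].
apply: negligible_bigcup => n; rewrite /F; case: unpickle => [[x k]|]; last exact: negligible_set0.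
have mF : measurable [set w | E x k w < 0] by exact: measurable_ltr_set.
have mG : measurable (E x k @^-1` `[0, +oo[%classic).
  by have := mE x k measurableT `[0, +oo[%classic (measurable_itv _); rewrite setTI.
have G1 : P (E x k @^-1` `[0, +oo[%classic) = 1%E by rewrite prob_E_ge// mulr0 oppr0 expR0.
have FE : [set w | E x k w < 0] = ~` (E x k @^-1` `[0, +oo[%classic).
  apply/seteqP; split => w /=; rewrite in_itv/= andbT ltNge; first by move/negP.
  by move/negP.
have P0 : P (~` (E x k @^-1` `[0, +oo[%classic)) = 0%E.
  by rewrite probability_setC// G1 subee.
by rewrite FE; exists (~` (E x k @^-1` `[0, +oo[%classic)); split => //; exact: measurableC.
Qed.

Lemma mark_timeS x k w : mark_time E x k.+1 w = mark_time E x k w + E x k.+1 w.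
Proof. by rewrite /mark_time big_ord_recr. Qed.

(** The latest mark was the minimum of all the pending ones, and since then only the clock that rang
    has moved, forward by a nonnegative gap. *)
Lemma overshoot_ge0 h w g : nonneg_gaps w -> Hist N E B x1 x2 h w -> g \in s ->
  clock E x1 x2 h w <= mark_time E g (cnt h g) w.
Proof.
move=> Ow; case: h => [|[e b] h] hw gs.
  by rewrite /clock /mark_time big_ord_recr big_ord0 /= add0r.
move: hw; rewrite HistS => -[[_ /= ne] _].
have le : mark_time E e (cnt h e) w <= mark_time E g (cnt h g) w.
  rewrite -ne; exact: (@argmin_seq_le _ _ (fun e => mark_time E e (cnt h e) w)).
case: ifP => // _; rewrite mark_timeS; apply: le_trans le _.
by rewrite lerDl.
Qed.

Lemma cnt_le_size h g : (cnt h g <= size h)%N.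
Proof. by elim: h => //= p h IH; case: ifP => _; rewrite ?ltnS// leqW. Qed.

(** The pending mark of [g] has index [cnt h g]. Its gap has partly elapsed and is seen through the
    overshoot, so [gaps_ge] starts at the next index; its type is still unread, so [coins_in] starts
    at [cnt h g]. The cutoff [K] leaves finitely many constraints, as the product formula for
    independence requires. *)
Definition overshoots_ge (v : int -> nat -> R) (h : seq (int * bool)) : set T :=
  [set w | forall g, g \in s ->
     v g (cnt h g) <= mark_time E g (cnt h g) w - clock E x1 x2 h w].

Definition gaps_ge K (v : int -> nat -> R) (h : seq (int * bool)) : set T :=
  [set w | forall g k, g \in s -> (cnt h g < k < K)%N -> v g k <= E g k w].

Definition coins_in K (C : int -> nat -> set bool) (h : seq (int * bool)) : set T :=
  [set w | forall g k, g \in s -> (cnt h g <= k < K)%N -> C g k (B g k w)].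

Let measurable_overshoots_ge v h : measurable (overshoots_ge v h).
Proof.
apply: (@measurable_forall _ _ int) => g; apply: measurable_imply; apply: measurable_ler_set => //.
by apply: measurable_funB; [exact: measurable_mark_time|exact: measurable_clock].
Qed.

Let measurable_gaps_ge K v h : measurable (gaps_ge K v h).
Proof.
apply: (@measurable_forall _ _ int) => g; apply: (@measurable_forall _ _ nat) => k.
do 2!apply: measurable_imply.
exact: measurable_ler_set.
Qed.

Let measurable_coins_in K C h : measurable (coins_in K C h).
Proof.
apply: (@measurable_forall _ _ int) => g; apply: (@measurable_forall _ _ nat) => k.
do 2!apply: measurable_imply.
by have := mB g k measurableT (C g k) I; rewrite setTI.
Qed.

Definition future K v C h : set T :=
  nonneg_gaps `&` Hist N E B x1 x2 h `&` gaps_ge K v h `&` coins_in K C h `&` overshoots_ge v h.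

(** What fresh clocks and fresh coins would give: the overshoot of a pending mark gets the tail of a
    whole exponential gap. *)
Definition future_prob K v C h : R :=
  \prod_(g <- s) \prod_(cnt h g <= k < K) (expR (- (lam * v g k)) * pcoin (C g k)).

Let rho (th : R) := jump_weight N th.

Let mHist h : measurable (Hist N E B x1 x2 h).
Proof. exact: measurable_Hist. Qed.

Let measurable_future K v C h : measurable (future K v C h).
Proof. by do 4![apply: measurableI => //]; exact: measurable_nonneg_gaps. Qed.

(** Independence enters here. Before any mark the overshoot is the gap of index 0, so the
    constraints bear on distinct gaps and types and their probabilities multiply. *)
Lemma prob_future_nil K v C : (0 < K)%N -> (forall g k, 0 <= v g k) ->
  P (future K v C [::]) = (future_prob K v C [::])%:E.
Proof.
move=> K0 v0.
pose A (i : int * nat * bool) : set T := let: (g, k, b) := i in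
  if b then B g k @^-1` (C g k) else E g k @^-1` `[v g k, +oo[%classic.
pose Idx : seq (int * nat * bool) :=
  [seq (gk, b) | gk <- [seq (g, k) | g <- s, k <- iota 0 K], b <- [:: false; true]].
have memIdx g k b : ((g, k, b) \in Idx) = (g \in s) && (k < K)%N.
  apply/allpairsP/andP => [[[gk c] /= [/allpairsP[[g' k'] /= [gs kK ->]] _ [-> -> _]]]|[gs kK]].
    by move: kK; rewrite mem_iota.
  exists ((g, k), b); split => //=; last by case: b; rewrite !inE.
  by apply/allpairsP; exists (g, k); rewrite mem_iota.
have uIdx : uniq Idx.
  apply: allpairs_uniq => //; last by move=> [[? ?] ?] [[? ?] ?] _ _ /= [-> -> ->].
  apply: allpairs_uniq; [exact: inner_edges_uniq|exact: iota_uniq|].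
  by move=> [? ?] [? ?] _ _ /= [-> ->].
have AE i : i \in Idx -> (let: (x, k, b) := i in
   if b then [set B x k @^-1` A | A in [set: set bool]]
   else [set E x k @^-1` A | A in [set A : set R | measurable A]]) (A i).
  case: i => [[g k] [|]] _ /=; first by exists (C g k).
  by exists `[v g k, +oo[%classic => //; exact: measurable_itv.
have mut := MP; case: mut => _ _ _ _ /(_ Idx uIdx A AE) mut.
have FE : future K v C [::] = nonneg_gaps `&` \bigcap_(i in [set` Idx]) A i.
  apply/seteqP; split => w; rewrite /future.
    move=> [[[[Ow _] gw] cw] ow]; split => // -[[g k] b] /=; rewrite memIdx => /andP[gs kK].
    case: b => /=; first exact: cw.
    rewrite in_itv/= andbT; case: k kK => [_|k kK]; last exact: gw.
    by have := ow g gs; rewrite /= subr0 /mark_time big_ord_recr big_ord0 /= add0r.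
  move=> [Ow Aw]; split; [split; [split; [by split|]|]|].
  - move=> g k gs /andP[_ kK]; have := Aw (g, k, false); rewrite /= memIdx gs kK /=.
    by rewrite in_itv/= andbT; apply.
  - by move=> g k gs /andP[_ kK]; have := Aw (g, k, true); rewrite /= memIdx gs kK /=; apply.
  - move=> g gs; have := Aw (g, 0%N, false); rewrite /= memIdx gs K0 /=.
    by rewrite in_itv/= andbT /= subr0 /mark_time big_ord_recr big_ord0 /= add0r; apply.
have mA i : measurable (A i).
  case: i => [[g k] [|]] /=.
    by have := mB g k measurableT (C g k) I; rewrite setTI.
  by have := mE g k measurableT `[v g k, +oo[%classic (measurable_itv _); rewrite setTI.
rewrite FE prob_nonneg_gapsI; last first.
  by rewrite bigcap_seq; apply: bigsetI_measurable.
rewrite mut /future_prob !big_allpairs_dep -prodEFin; apply: eq_bigr => g _.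
rewrite -prodEFin /= /index_iota subn0; apply: eq_bigr => k _.
by rewrite big_cons big_seq1 /= prob_E_ge// prob_B.
Qed.

(* The tails of the overshoots and the laws of all unused marks are carried along with the
   history: this replaces conditioning in the induction. *)
Lemma integral_future th K v C h : 0 <= th -> (size h < K)%N ->
  (forall p, p \in h -> p.1 \in s) -> (forall g k, 0 <= v g k) ->
  (\int[P]_(w in future K v C h) (expR (- (th * clock E x1 x2 h w)))%:E =
   (rho th ^+ size h * future_prob K v C h)%:E)%E.
Proof.
move=> th0; elim: h v C => [|[e b] h IH] v C hK hs v0.
  under eq_integral do rewrite /= mulr0 oppr0 expR0.
  rewrite integral_cst//.
  by rewrite expr0 mul1e mul1r; exact: prob_future_nil.
have es : e \in s by apply: (hs (e, b)); rewrite mem_head.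
have hs' p : p \in h -> p.1 \in s by move=> ph; apply: hs; rewrite inE ph orbT.
have {}hK : ((size h).+1 < K)%N by [].
have ceK : (cnt h e < K)%N by apply: leq_ltn_trans (cnt_le_size _ _) (ltnW hK).
have cK g : (cnt h g < K)%N by apply: leq_ltn_trans (cnt_le_size _ _) (ltnW hK).
(* The type of the ringing mark is imposed; this produces the factor [1 / 2]. *)
pose C' g k := if (g == e) && (k == cnt h e) then [set b] else C g k.
pose D := nonneg_gaps `&` Hist N E B x1 x2 h `&` gaps_ge K v h `&` coins_in K C' h.
pose G (a : R) := [set w | forall g, g \in s -> g != e ->
  a + v g (cnt h g) <= mark_time E g (cnt h g) w - clock E x1 x2 h w].
pose f w := mark_time E e (cnt h e) w - clock E x1 x2 h w.
pose Z := D `&` [set w | next_edge N E w (hstate x1 x2 h) = e] `&`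
  [set w | forall g, g \in s -> g != e ->
     v g (cnt h g) <= mark_time E g (cnt h g) w - mark_time E e (cnt h e) w].
have gapS w : mark_time E e (cnt h e).+1 w - mark_time E e (cnt h e) w = E e (cnt h e).+1 w.
  by rewrite mark_timeS addrC addKr.
have FE : future K v C ((e, b) :: h) = Z.
  apply/seteqP; split => w; rewrite /future HistS /Z /D.
    move=> [[[[Ow [[hw /= ne] Bw]] gw] cw] ow].
    split; [split; [split; [split; [by split|]|]|by []]|].
    - move=> g k gs /andP[k1 k2].
      have [ge|ge] := eqVneq g e; last first.
        by apply: gw => //=; rewrite (negbTE ge) k1.
      subst g; have [->|nk] := eqVneq k (cnt h e).+1.
        by have := ow e es; rewrite /= eqxx gapS.
      by apply: gw => //=; rewrite eqxx ltn_neqAle eq_sym nk k1.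
    - move=> g k gs /andP[k1 k2]; rewrite /C'; case: ifP => [/andP[/eqP-> /eqP->]//|nk].
      apply: cw => //=; case: eqP => [ge|_]; rewrite k2 andbT//.
      rewrite ltn_neqAle k1 andbT; apply: contraFneq nk => <-.
      by rewrite ge !eqxx.
    - by move=> g gs ge; have := ow g gs; rewrite /= (negbTE ge).
  move=> [[[[[Ow hw] gw] cw] ne] ow].
  split; [split; [split; [split; [by []|split; [by split|]]|]|]|].
  - by have := cw e (cnt h e) es; rewrite leqnn ceK /C' !eqxx; apply.
  - move=> g k gs /= /andP[k1 k2]; apply: gw => //; rewrite k2 andbT.
    by move: k1; case: ifP => // _ /ltnW.
  - move=> g k gs /= /andP[k1 k2].
    have := cw g k gs; rewrite k2 andbT /C'; case: ifP => [/andP[/eqP ge /eqP ke]|nk].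
      by move: k1; rewrite ge ke eqxx ltnn.
    by apply; move: k1; case: ifP => // _ /ltnW.
  - move=> g gs /=; case: ifPn => [/eqP->|ge]; last exact: ow.
    by rewrite gapS; apply: gw => //; rewrite ltnSn /= (leq_ltn_trans _ hK)// ltnS cnt_le_size.
have mD : measurable D.
  by do 3![apply: measurableI => //]; exact: measurable_nonneg_gaps.
have mf : measurable_fun setT f.
  by apply: measurable_funB; [exact: measurable_mark_time|exact: measurable_clock].
have mG a : measurable (G a).
  apply: (@measurable_forall _ _ int) => g; do 2!apply: measurable_imply.
  apply: measurable_ler_set => //.
  by apply: measurable_funB; [exact: measurable_mark_time|exact: measurable_clock].
have mZ : measurable Z.
  apply: measurableI; first by apply: measurableI => //; exact: measurable_next_edge.
  apply: (@measurable_forall _ _ int) => g; do 2!apply: measurable_imply.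
  apply: measurable_ler_set => //.
  by apply: measurable_funB; exact: measurable_mark_time.
pose A g := \prod_((cnt h g).+1 <= k < K) (expR (- (lam * v g k)) * pcoin (C g k)).
pose Q := \prod_(g <- s | g != e) (expR (- (lam * v g (cnt h g))) * pcoin (C g (cnt h g)) * A g).
have A0 g : 0 <= A g.
  by rewrite prodr_ge0// => k _; rewrite mulr_ge0 ?expR_ge0// fine_ge0// pcoinE lee_fin addr_ge0// mulr_ge0.
have Q0 : 0 <= Q.
  by rewrite prodr_ge0// => g _; rewrite !mulr_ge0 ?expR_ge0// fine_ge0// pcoinE lee_fin addr_ge0// mulr_ge0.
(* Total rate of the [2 * N - 1] competing clocks. *)
pose nu := (2 * N).-1%:R * lam.
have rho0 : 0 <= rho th.
  by rewrite /rho /jump_weight divr_ge0 ?(ltW lam0)// mulr_ge0// addr_ge0// mulr_ge0// ltW.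
have iW (a c : R) : 0 <= a -> 0 <= c ->
  (\int[P]_(w in D `&` [set w | (a <= f w)%R] `&` G c) (expR (- (th * clock E x1 x2 h w)))%:E =
   (rho th ^+ size h * 2^-1 * A e * Q * expR (- (lam * a)) * expR (- (nu * c)))%:E)%E.
  move=> a0 c0.
  (* The event [W a c] is itself a [future] of [h] with shifted thresholds, so the induction
     hypothesis supplies the joint tails. This is why [v] and [C] are arbitrary in the induction. *)
  pose v' g k := if k == cnt h g then if g == e then a else c + v g k else v g k.
  have vk g k : (cnt h g < k)%N -> v' g k = v g k by move=> k1; rewrite /v' gtn_eqF.
  have -> : D `&` [set w | a <= f w] `&` G c = future K v' C' h.
    apply/seteqP; split => w; rewrite /D /future.
      move=> [[[[Oh gw] cw] fa] Gc]; split; [split; [split; [by []|]|by []]|].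
        by move=> g k gs /andP[k1 k2]; rewrite vk//; apply: gw; rewrite // k1.
      move=> g gs; rewrite /v' eqxx; case: ifPn => [/eqP->//|ge]; exact: Gc.
    move=> [[[Oh gw] cw] ow]; split; [split; [split; [split; [by []|]|by []]|]|].
    - by move=> g k gs /andP[k1 k2]; rewrite -vk//; apply: gw; rewrite // k1.
    - by have := ow e es; rewrite /v' !eqxx.
    - by move=> g gs ge; have := ow g gs; rewrite /v' eqxx (negbTE ge).
  rewrite IH//; last first.
  - by move=> g k; rewrite /v'; case: ifP => // _; case: ifP => // _; rewrite addr_ge0.
  - exact: ltnW.
  suff -> : future_prob K v' C' h = 2^-1 * A e * Q * expR (- (lam * a)) * expR (- (nu * c)).
    by congr EFin; ring.
  rewrite /future_prob.
  have -> : \prod_(g <- s) \prod_(cnt h g <= k < K) (expR (- (lam * v' g k)) * pcoin (C' g k))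
    = \prod_(g <- s) (expR (- (lam * v' g (cnt h g))) * pcoin (C' g (cnt h g)) * A g).
    apply: eq_bigr => g _; rewrite big_ltn//; congr (_ * _).
    rewrite /A !big_nat; apply: eq_bigr => k /andP[k1 _].
    rewrite vk// /C'; case: eqP => //= ge; rewrite gtn_eqF//.
    by rewrite -ge.
  rewrite (bigD1_seq e) ?inner_edges_uniq//= /v' /C' !eqxx /= pcoin1.
  have -> : \prod_(g <- s | g != e) (expR (- (lam * (if cnt h g == cnt h g then
        if g == e then a else c + v g (cnt h g) else v g (cnt h g)))) *
      pcoin (if (g == e) && (cnt h g == cnt h e) then [set b] else C g (cnt h g)) * A g)
    = \prod_(g <- s | g != e) expR (- (lam * c)) * Q.
    rewrite -big_split; apply: eq_bigr => g ge /=.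
    by rewrite eqxx (negbTE ge) /= mulrDr opprD expRD; ring.
  have -> : \prod_(g <- s | g != e) expR (- (lam * c)) = expR (- (nu * c)) :> R.
    have ce : count (fun g => g != e) s = (2 * N).-1.
      have := count_predC (pred1 e) s.
      by rewrite count_uniq_mem ?inner_edges_uniq// es size_inner_edges => <-.
    rewrite big_const_seq ce iter_mulr_1 -expRM_natl; congr expR; rewrite /nu; ring.
  by ring.
have ZG w : Z w -> [/\ D w, 0 <= f w & G (f w) w].
  move=> [[Dw ne] ow]; split => //.
    by rewrite subr_ge0; apply: overshoot_ge0 => //; case: Dw => -[[]].
  by move=> g gs ge; have := ow g gs ge; rewrite /f; lra.
have GZ w (c : R) : D w -> 0 <= f w -> f w < c -> G c w -> Z w.
  move=> Dw f0 fc Gc; split; first split => //.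
    rewrite /next_edge; apply: argmin_seqP => // g gs ge.
    have := Gc g gs ge; have := v0 g (cnt h g); move: fc; rewrite /f /=; lra.
  by move=> g gs ge; have := Gc g gs ge; move: fc; rewrite /f; lra.
have Ga (a c : R) w : a <= c -> G c w -> G a w.
  by move=> ac Gc g gs ge; apply: le_trans (Gc g gs ge); rewrite lerD2r.
have mY : measurable_fun setT (fun w => expR (- (th * clock E x1 x2 h w))).
  apply: measurableT_comp => //; apply: measurableT_comp => //.
  by apply: measurable_funM => //; exact: measurable_clock.
have nu0 : 0 <= nu by rewrite mulr_ge0// ltW.
have C0 : 0 <= rho th ^+ size h * 2^-1 * A e * Q by rewrite !mulr_ge0// exprn_ge0.
have := @winning_clock_laplace _ _ _ P D Z G (fun w => expR (- (th * clock E x1 x2 h w))) f lam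
  nu th _ mD mZ mG mY mf (fun w => expR_ge0 _) lam0 nu0 th0 C0 ZG GZ Ga iW.
rewrite FE => WC.
have -> : (\int[P]_(w in Z) (expR (- (th * clock E x1 x2 ((e, b) :: h) w)))%:E =
  \int[P]_(w in Z) (expR (- (th * clock E x1 x2 h w)) * expR (- (th * f w)))%:E)%E.
  by apply: eq_integral => w _; rewrite -expRD; congr (expR _)%:E; rewrite /f /=; ring.
rewrite WC; congr EFin.
have -> : lam + nu + th = (2 * N)%:R * lam + th.
  by rewrite /nu -[in RHS](@prednK (2 * N)) ?muln_gt0// -natr1; ring.
have -> : future_prob K v C ((e, b) :: h) = A e * Q.
  rewrite /future_prob (bigD1_seq e) ?inner_edges_uniq//= eqxx; congr (_ * _).
  by apply: eq_bigr => g ge; rewrite (negbTE ge) big_ltn.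
have n0 : (2 * N)%:R * lam + th != 0.
  by rewrite gt_eqF// ltr_pwDl// mulr_gt0// ltr0n muln_gt0.
by rewrite exprS /rho /jump_weight -/lam; field; rewrite -natrM.
Qed.

Lemma integral_Hist th n h : 0 <= th -> h \in hists N n ->
  (\int[P]_(w in nonneg_gaps `&` Hist N E B x1 x2 h)
     (expR (- (th * clock E x1 x2 h w)))%:E = (jump_weight N th ^+ n)%:E)%E.
Proof.
move=> th0 hn; have hs := mem_hists N n h hn.
(* Zero thresholds and unrestricted types add no constraint, overshoots being nonnegative on
   [nonneg_gaps]. *)
have <- : future (size h).+1 (fun _ _ => 0) (fun _ _ => setT) h =
    nonneg_gaps `&` Hist N E B x1 x2 h.
  apply/seteqP; split => w; first by move=> [[[]]].
  move=> [Ow hw]; split; [split; [split; [by []|]|by []]|].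
    by move=> g k _ _; exact: Ow.
  by move=> g gs; rewrite subr_ge0; exact: overshoot_ge0.
rewrite integral_future// (size_hists _ _ _ hn) [X in _ * X](_ : _ = 1) ?mulr1//.
rewrite /future_prob big1// => g _; rewrite big1// => k _.
by rewrite mulr0 oppr0 expR0 pcoinT mulr1.
Qed.

Lemma prob_Hist n h : h \in hists N n ->
  P (nonneg_gaps `&` Hist N E B x1 x2 h) = (jump_weight N (0 : R) ^+ n)%:E.
Proof.
move=> hn; rewrite -(integral_Hist _ _ _ (lexx 0) hn).
under eq_integral do rewrite mul0r oppr0 expR0.
rewrite integral_cst ?mul1e//.
by apply: measurableI => //; exact: measurable_nonneg_gaps.
Qed.

End memoryless.

Arguments hists N n : simpl never.

(** * Collision trees *)

Section collision_tree.
Context {R : realType}.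
Variables (N : nat) (x1 x2 : int).
Local Notation ncoll := (ncoll x1 x2).
Local Notation hcoll := (hcoll x1 x2).
Implicit Type h : seq (int * bool).

Definition first_hit (m : nat) h : bool := (ncoll h == m) && hcoll h.

Let first_hit_alive m p h : (0 < m)%N ->
  ((first_hit m (p :: h) : nat) + (ncoll (p :: h) < m) = (ncoll h < m))%N.
Proof.
rewrite /first_hit -[ncoll (_ :: _)]/(hcoll (p :: h) + ncoll h)%N.
case: (hcoll (p :: h)) => m0; rewrite ?andbF ?add0n// andbT add1n.
by rewrite (leq_eqVlt (ncoll h).+1); case: eqVneq => [->|//]; rewrite ltnn.
Qed.

(* A collision tree is cut at its [m]-th collision: summing a superharmonic function over
   the leaves reached before depth [n] and over the branches still alive at depth [n] gives
   at most its value at the root. *)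
Lemma sum_tree_le (rho : R) (F : seq (int * bool) -> R) (m n : nat) : 0 <= rho -> (0 < m)%N ->
  (forall n h, h \in hists N n -> (ncoll h < m)%N ->
     rho * \sum_(e <- inner_edges N) (F ((e, true) :: h) + F ((e, false) :: h)) <= F h) ->
  \sum_(j < n) \sum_(h <- hists N j.+1 | first_hit m h) rho ^+ j.+1 * F h
  + \sum_(h <- hists N n | (ncoll h < m)%N) rho ^+ n * F h <= F [::].
Proof.
move=> rho0 m0 HF; elim: n => [|n IH].
  by rewrite big_ord0 add0r big_mkcond big_seq1 /= m0 expr0 mul1r.
rewrite big_ord_recr /= -addrA; apply: le_trans IH; rewrite lerD2l.
rewrite [X in X + _ <= _]big_mkcond [X in _ + X <= _]big_mkcond -big_split [leRHS]big_mkcond.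
rewrite big_histsS.
rewrite !big_seq; apply: ler_sum => h hn.
have E e b : (if first_hit m ((e, b) :: h) then rho ^+ n.+1 * F ((e, b) :: h) else 0) +
    (if (ncoll ((e, b) :: h) < m)%N then rho ^+ n.+1 * F ((e, b) :: h) else 0)
    = (ncoll h < m)%N%:R * (rho ^+ n.+1 * F ((e, b) :: h)).
  rewrite -(first_hit_alive _ (e, b))// natrD mulrDl.
  by case: ifP => _; case: ifP => _; rewrite ?mul1r ?mul0r.
rewrite (eq_bigr (fun e => (ncoll h < m)%N%:R *
    (rho ^+ n.+1 * (F ((e, true) :: h) + F ((e, false) :: h))))); last first.
  by move=> e _ /=; rewrite !E -mulrDr -mulrDr.
rewrite -mulr_sumr; case: ifP => hm; rewrite ?mul0r// mul1r.
rewrite -mulr_sumr exprSr -mulrA ler_wpM2l ?exprn_ge0//; exact: HF hn hm.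
Qed.

Lemma sum_tree_ge (rho : R) (F : seq (int * bool) -> R) (m n : nat) : 0 <= rho -> (0 < m)%N ->
  (forall n h, h \in hists N n -> (ncoll h < m)%N ->
     F h <= rho * \sum_(e <- inner_edges N) (F ((e, true) :: h) + F ((e, false) :: h))) ->
  F [::] <= \sum_(j < n) \sum_(h <- hists N j.+1 | first_hit m h) rho ^+ j.+1 * F h
  + \sum_(h <- hists N n | (ncoll h < m)%N) rho ^+ n * F h.
Proof.
move=> rho0 m0 HF.
rewrite -lerN2 opprD -sumrN -sumrN.
have := @sum_tree_le rho (fun h => - F h) m n rho0 m0; under eq_bigr do under eq_bigr do rewrite mulrN.
under eq_bigr do rewrite sumrN.
under [X in _ + X]eq_bigr do rewrite mulrN.
apply=> k h hk hm; under eq_bigr do rewrite -opprD.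
by rewrite sumrN mulrN lerN2; exact: HF hk hm.
Qed.

Lemma sum_hists_cst n (c : R) : \sum_(h <- hists N n) c = (4 * N)%:R ^+ n * c.
Proof.
elim: n => [|n IH]; first by rewrite big_seq1 expr0 mul1r.
rewrite big_histsS.
under eq_bigr do rewrite big_const_seq count_predT iter_addr_0 size_inner_edges -mulr2n -mulrnA.
by rewrite sumrMnl IH -[LHS]mulr_natl mulrA exprS; congr (_%:R * _ * _); lia.
Qed.

Lemma jump_weight_ge0 (th : R) : 0 <= th -> 0 <= jump_weight N th.
Proof. by move=> th0; rewrite divr_ge0// mulr_ge0// addr_ge0// mulr_ge0. Qed.

End collision_tree.

(** * From events about collisions to weighted sums over histories *)

Section collision_times.
Context {d : measure_display} {T : measurableType d} {R : realType}.
Variables (N : nat) (P : probability T R).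
Variables (E : int -> nat -> T -> R) (B : int -> nat -> T -> bool).
Variables (x1 x2 : int).
Hypotheses (N0 : (0 < N)%N) (MP : marks_process N P E B).

Local Notation ncoll := (ncoll x1 x2).
Local Notation hcoll := (hcoll x1 x2).
Local Notation clock := (clock E x1 x2).
Local Notation hist_of := (hist_of N E B x1 x2).
Local Notation Hist := (Hist N E B x1 x2).
Local Notation nonneg_gaps := (nonneg_gaps E).
Local Notation first_hit := (first_hit x1 x2).

Let mE x k : measurable_fun setT (E x k). Proof. by case: MP => + _ _ _ _; apply. Qed.
Let mB x k : measurable_fun setT (B x k). Proof. by case: MP => _ + _ _ _; apply. Qed.
Let mclock h : measurable_fun setT (clock h). Proof. exact: measurable_clock. Qed.
Let mO : measurable nonneg_gaps. Proof. exact: (measurable_nonneg_gaps _ _ _ _ MP). Qed.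
Let mHist h : measurable (Hist h). Proof. exact: measurable_Hist. Qed.

Lemma clock_hist_of_le w m n : nonneg_gaps w -> (m <= n)%N ->
  clock (hist_of w m) w <= clock (hist_of w n) w.
Proof.
move=> Ow; elim: n => [|n IH]; first by rewrite leqn0 => /eqP->.
rewrite leq_eqVlt => /orP[/eqP->//|]; rewrite ltnS => /IH/le_trans; apply.
set e := next_edge N E w (hstate x1 x2 (hist_of w n)).
rewrite -[leRHS]/(mark_time E e ((hstate x1 x2 (hist_of w n)).1 e) w).
apply: overshoot_ge0 => //; first exact: Hist_hist_of.
exact: next_edge_in.
Qed.

Lemma clock_hist_of_ge0 w n : nonneg_gaps w -> 0 <= clock (hist_of w n) w.
Proof. by move=> Ow; exact: (clock_hist_of_le w 0 n Ow). Qed.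

Lemma first_hit_exists w m n : (0 < m)%N -> (m <= ncoll (hist_of w n))%N ->
  exists2 j, (j < n)%N & first_hit m (hist_of w j.+1).
Proof.
move=> m0; elim: n => [|n IH]; first by rewrite leqn0 => /eqP m00; rewrite m00 in m0.
case: (leqP m (ncoll (hist_of w n))) => [/IH[j jn fj] _|lt ge].
  by exists j => //; exact: ltnW.
exists n => //; move: ge; rewrite /first_hit.
rewrite -[ncoll (hist_of w n.+1)]/(hcoll (hist_of w n.+1) + ncoll (hist_of w n))%N.
by case: (hcoll _) => /=; rewrite ?add1n ?add0n ?andbT; lia.
Qed.

Definition early_collision (t : R) (w : T) (n : nat) : bool :=
  collision N E B x1 x2 w n && (event_time N E B x1 x2 w n <= t).

(* On [nonneg_gaps] the event times are nondecreasing, so that the [m]-th collision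
   occurs before [t] as soon as [m] collisions do. *)
Lemma first_hit_before w (t : R) m n : nonneg_gaps w -> (0 < m)%N ->
  (m <= count (early_collision t w) (iota 0 n))%N ->
  exists j, first_hit m (hist_of w j.+1) /\ clock (hist_of w j.+1) w <= t.
Proof.
move=> Ow m0; elim: n => [|n IH]; first by rewrite leqn0 => /eqP m00; rewrite m00 in m0.
rewrite -addn1 iotaD count_cat /= addn0 add0n.
rewrite /early_collision collisionE event_timeE -/(early_collision t w).
case: (boolP (hcoll _ && _)) => [/andP[hc ct]|_]; last by rewrite addn0.
case: (leqP m (count (early_collision t w) (iota 0 n))) => [/IH//|lt ge].
have E0 k : (k <= n)%N -> count (early_collision t w) (iota 0 k) = ncoll (hist_of w k).
  elim: k => [//|k IHk] kn.
  rewrite -addn1 iotaD count_cat /= addn0 add0n IHk ?(ltnW kn)// /early_collision collisionE event_timeE addnC addn1.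
  congr (nat_of_bool _ + _)%N.
  rewrite (_ : (_ <= t) = true) ?andbT//; apply: le_trans ct.
  by apply: clock_hist_of_le => //; exact: ltnW.
exists n; split => //; rewrite /first_hit hc andbT.
rewrite -[ncoll (hist_of w n.+1)]/(hcoll (hist_of w n.+1) + ncoll (hist_of w n))%N hc.
by move: lt ge; rewrite E0//; lia.
Qed.

Lemma prob_le_sum_hists n (q : pred (seq (int * bool))) (Q : seq (int * bool) -> set T) (A : set T) :
  measurable A -> (forall h, measurable (Q h)) ->
  (forall w, A w -> nonneg_gaps w /\ q (hist_of w n) /\ Q (hist_of w n) w) ->
  (P A <= \sum_(h <- hists N n | q h) P (nonneg_gaps `&` Hist h `&` Q h))%E.
Proof.
move=> mA mQ AQ; pose F h := nonneg_gaps `&` Hist h `&` Q h.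
have mF h : measurable (F h) by apply: measurableI => //; exact: measurableI.
have sub l : (P (\big[setU/set0]_(h <- l | q h) F h) <= \sum_(h <- l | q h) P (F h))%E.
  elim: l => [|h l IH]; first by rewrite !big_nil measure0.
  rewrite !big_cons; case: ifP => // _.
  apply: le_trans (measureU2 _ _ _) _ => //; first exact: bigsetU_measurable.
  exact: leeD.
apply: le_trans (sub _); apply: le_measure; rewrite ?inE//; first exact: bigsetU_measurable.
move=> w /AQ[Ow [qw Qw]]; rewrite -bigcup_seq_cond.
exists (hist_of w n) => /=; first by rewrite hist_of_in.
by split => //; split => //; exact: Hist_hist_of.
Qed.

Let mA h : measurable (nonneg_gaps `&` Hist h). Proof. exact: measurableI. Qed.
Let mle (t : R) h : measurable [set w | clock h w <= t]. Proof. exact: measurable_ler_set. Qed.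
Let mge (t : R) h : measurable [set w | t <= clock h w]. Proof. exact: measurable_ler_set. Qed.
Let mlt (t : R) h : measurable [set w | clock h w < t]. Proof. exact: measurable_ltr_set. Qed.
Let mexp (th : R) h : measurable_fun setT (fun w => expR (- (th * clock h w))).
Proof. by apply: measurableT_comp => //; apply: measurableT_comp => //; exact: measurable_funM. Qed.

(** Exponential Markov inequality: [exp (1 - clock / t)] is at least 1 where the clock is at most
    [t]. *)
Lemma prob_Hist_early t n h : 0 < t -> h \in hists N n ->
  (P (nonneg_gaps `&` Hist h `&` [set w | (clock h w <= t)%R])
    <= (expR 1 * jump_weight N t^-1 ^+ n)%:E)%E.
Proof.
move=> t0 hn; have ti : 0 <= t^-1 by rewrite invr_ge0 ltW.
set A := _ `&` [set w | _]; have mAt : measurable A by exact: measurableI.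
rewrite EFinM -(integral_Hist _ P E B x1 x2 N0 MP _ _ _ ti hn).
rewrite -ge0_integral_EFinZl ?expR_ge0//.
have -> : P A = (\int[P]_(w in A) 1%:E)%E by rewrite integral_EFin_cst// mul1e.
apply: (@le_trans _ _ (\int[P]_(w in A) (expR 1 * expR (- (t^-1 * clock h w)))%:E)%E).
  apply: ge0_le_integral_EFin => //; first exact: measurable_funM.
  move=> w [_ /= ct]; rewrite -expRD -[leLHS]expR0 ler_expR subr_ge0 mulrC ler_pdivrMr// mul1r.
  exact: ct.
have subA : A `<=` nonneg_gaps `&` Hist h by move=> w [].
by apply: ge0_subset_integral_EFin => //; exact: measurable_funM.
Qed.

(** Markov's inequality for [1 - exp (- clock / t)], which is at least [1 - exp (- 1)] where the
    clock is at least [t]; its integral over the history is the difference of the weights at 0 and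
    at [1 / t]. *)
Lemma prob_Hist_late t n h : 0 < t -> h \in hists N n ->
  P (nonneg_gaps `&` Hist h `&` [set w | (t <= clock h w)%R]) =
    (fine (P (nonneg_gaps `&` Hist h `&` [set w | (t <= clock h w)%R])))%:E /\
  (1 - expR (- 1)) * fine (P (nonneg_gaps `&` Hist h `&` [set w | (t <= clock h w)%R])) <=
   jump_weight N 0 ^+ n - jump_weight N t^-1 ^+ n.
Proof.
move=> t0 hn; have ti : 0 <= t^-1 by rewrite invr_ge0 ltW.
set A := _ `&` [set w | _]; pose A' := nonneg_gaps `&` Hist h `&` [set w | clock h w < t].
have mA1 : measurable A by exact: measurableI.
have mA2 : measurable A' by exact: measurableI.
have EA : P A = (fine (P A))%:E by rewrite fineK// fin_num_measure.
have EA' : P A' = (fine (P A'))%:E by rewrite fineK// fin_num_measure.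
split; first exact: EA.
have HE : nonneg_gaps `&` Hist h = A `|` A'.
  apply/seteqP; split => w; last by case=> -[].
  by move=> Aw; case: (leP t (clock h w)) => ct; [left|right].
have dA w : A w -> A' w -> False by move=> [_ /= h1] [_ /=]; rewrite ltNge h1.
have I0 : fine (P A) + fine (P A') = jump_weight N 0 ^+ n.
  have PH : P (nonneg_gaps `&` Hist h) = (jump_weight N (0 : R) ^+ n)%:E by exact: prob_Hist.
  apply: EFin_inj; rewrite EFinD -EA -EA' -PH HE.
  rewrite measureU//; apply/seteqP; split => // w [] /dA; exact.
have I1 : jump_weight N t^-1 ^+ n <= expR (- 1) * fine (P A) + fine (P A').
  rewrite -lee_fin -(integral_Hist _ P E B x1 x2 N0 MP _ _ _ ti hn) HE.
  rewrite ge0_integral_EFinU// EFinD; apply: leeD.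
    apply: (@le_trans _ _ (\int[P]_(w in A) (expR (- 1))%:E)%E).
      apply: ge0_le_integral_EFin => // w [_ /= ct].
      by rewrite ler_expR lerN2 mulrC ler_pdivlMr// mul1r.
    by rewrite integral_EFin_cst// EFinM -EA.
  apply: (@le_trans _ _ (\int[P]_(w in A') 1%:E)%E).
    apply: ge0_le_integral_EFin => // w [[Ow hw] _].
    rewrite -expR0 ler_expR oppr_le0 mulr_ge0//.
    by move: (hw : hist_of w (size h) = h) => <-; exact: clock_hist_of_ge0.
  by rewrite integral_EFin_cst// mul1e -EA'.
by move: I0 I1; lra.
Qed.

Lemma measurable_early_collision t n : measurable [set w | early_collision t w n].
Proof.
apply: (@measurable_by_hist _ _ _ N E B x1 x2 N0 mE mB n.+1 _
  (fun h w => hcoll h && (clock h w <= t))) => [h|w]; last first.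
  by rewrite /early_collision collisionE event_timeE.
case: (hcoll h) => /=; first exact: mle.
by rewrite (_ : [set w | _] = set0)//; apply/seteqP; split.
Qed.

Lemma measurable_Ncoll_ge t r : measurable (Ncoll_ge N E B x1 x2 t r).
Proof.
rewrite (_ : Ncoll_ge _ _ _ _ _ _ _ =
  \bigcup_m [set w | r <= \sum_(n <- iota 0 m) \1_[set w | early_collision t w n] w]).
  apply: bigcup_measurable => m _; apply: measurable_ler_set => //.
  by apply: measurable_sum => n; apply: measurable_indic; exact: measurable_early_collision.
have E0 w m : (count (early_collision t w) (iota 0 m))%:R =
    \sum_(n <- iota 0 m) \1_[set w | early_collision t w n] w :> R.
  rewrite -sum1_count big_mkcond natr_sum; apply: eq_bigr => n _.
  rewrite indicE; case: ifP => h; first by rewrite mem_set.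
  by rewrite memNset//= h.
by apply/seteqP; split => w; [move=> [m]|move=> [m _]]; rewrite /= -?E0; exists m; rewrite //= -?E0.
Qed.

(** With [m] the least integer above [r], the event is covered by the events that mark number [j] is
    the [m]-th collision and comes before [t]. Countable subadditivity reduces the claim to partial
    sums over [j]. *)
Lemma prob_Ncoll_ge_le t r (b : R) : 0 < t -> 0 < r ->
  (forall m n, (0 < m)%N -> r <= m%:R ->
    \sum_(j < n) \sum_(h <- hists N j.+1 | first_hit m h) jump_weight N t^-1 ^+ j.+1 <= b) ->
  (P (Ncoll_ge N E B x1 x2 t r) <= (expR 1 * b)%:E)%E.
Proof.
move=> t0 r0 Hb.
have [m [m0 rm mle_]] : exists m, [/\ (0 < m)%N, r <= m%:R & forall k : nat, r <= k%:R -> (m <= k)%N].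
  have ex : exists n : nat, r <= n%:R by exists (Num.bound r); apply: ltW; apply: archi_boundP; exact: ltW.
  case: (ex_minnP ex) => m rm mn; exists m; split => //.
  by rewrite -(ltr0n R); exact: lt_le_trans rm.
pose D j := nonneg_gaps `&` [set w | first_hit m (hist_of w j.+1) /\ clock (hist_of w j.+1) w <= t].
have mD j : measurable (D j).
  apply: measurableI => //.
  apply: (@measurable_by_hist _ _ _ N E B x1 x2 N0 mE mB j.+1 _
    (fun h w => first_hit m h /\ clock h w <= t)) => // h.
  by apply: measurable_and; [case: (first_hit m h); [rewrite (_ : [set w | _] = setT)|rewrite (_ : [set w | _] = set0)]; rewrite //; apply/seteqP; split|exact: mle].
have mN := measurable_Ncoll_ge t r.
rewrite -(prob_nonneg_gapsI _ _ _ _ N0 MP _ mN).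
have sub : nonneg_gaps `&` Ncoll_ge N E B x1 x2 t r `<=` \bigcup_j D j.
  move=> w [Ow [M /mle_]] /(first_hit_before _ _ _ _ Ow m0)[j jc].
  by exists j.
apply: le_trans (@measure_sigma_subadditive _ _ _ P _ D mD (measurableI _ _ mO mN) sub) _.
apply: lime_le; first exact: is_cvg_nneseries.
apply: nearW => n; rewrite big_mkord.
apply: (@le_trans _ _ (\sum_(j < n) (\sum_(h <- hists N j.+1 | first_hit m h) expR 1 * jump_weight N t^-1 ^+ j.+1)%:E)%E).
  apply: lee_sum => j _.
  have DQ w : D j w -> nonneg_gaps w /\ first_hit m (hist_of w j.+1) /\ [set w | (clock (hist_of w j.+1) w <= t)%R] w.
    by [].
  apply: le_trans (prob_le_sum_hists j.+1 (first_hit m) _ _ (mD j) (mle t) DQ) _.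
  rewrite -sumEFin big_seq_cond [leRHS]big_seq_cond.
  by apply: lee_sum => h /andP[hn _]; exact: prob_Hist_early.
rewrite sumEFin lee_fin; under eq_bigr do rewrite -mulr_sumr.
by rewrite -mulr_sumr ler_wpM2l ?expR_ge0// Hb.
Qed.

Lemma measurable_tau_ge t : measurable (tau_ge N E B x1 x2 t).
Proof.
apply: (@measurable_forall _ _ nat) => n; apply: (@measurable_by_hist _ _ _ N E B x1 x2 N0 mE mB n.+1 _
  (fun h w => hcoll h -> t <= clock h w)) => [h|w]; last by rewrite collisionE event_timeE.
by apply: measurable_imply; exact: mge.
Qed.

(** At [th = 0] each of the [4 * N] continuations of a history has weight [1 / (4 * N)], so
    constants are harmonic. *)
Lemma sum_hists_jump_weight0 n :
  \sum_(j < n) \sum_(h <- hists N j.+1 | first_hit 1 h) jump_weight N (0 : R) ^+ j.+1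
  + \sum_(h <- hists N n | (ncoll h < 1)%N) jump_weight N (0 : R) ^+ n <= 1.
Proof.
have w0 := jump_weight_ge0 N _ (lexx (0 : R)).
apply: le_trans (sum_tree_le N x1 x2 _ (fun _ => 1) 1 n w0 isT _).
  rewrite le_eqVlt; apply/orP; left; apply/eqP; congr (_ + _).
    by apply: eq_bigr => j _; apply: eq_bigr => h _; rewrite mulr1.
  by apply: eq_bigr => h _; rewrite mulr1.
move=> k h hk _; rewrite big_const_seq count_predT iter_addr_0 size_inner_edges.
rewrite le_eqVlt; apply/orP; left; apply/eqP; rewrite /jump_weight addr0 -mulr_natl natrM.
have n0 : N%:R != 0 :> R by rewrite pnatr_eq0 -lt0n.
by field.
Qed.

(** The left side is the Laplace transform at [1 / t] of the time of the [n]-th mark, that is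
    [(1 + 1 / z) ^ - n] with [z] the mean number of marks before [t]; Bernoulli's inequality gives
    decay in [n]. *)
Lemma total_weight_le t n : 0 < t -> (0 < n)%N ->
  (4 * N)%:R ^+ n * jump_weight N t^-1 ^+ n <= (2 * N)%:R * N%:R ^+ 2 * t / n%:R :> R.
Proof.
move=> t0 n0; have N0' : 0 < N%:R :> R by rewrite ltr0n.
set z := (2 * N)%:R * N%:R ^+ 2 * t.
have z0 : 0 < z by rewrite !mulr_gt0// ?exprn_gt0// ltr0n muln_gt0.
have -> : (4 * N)%:R ^+ n * jump_weight N t^-1 ^+ n = ((1 + z^-1) ^+ n)^-1.
  rewrite -exprMn -exprVn; congr (_ ^+ _); rewrite /jump_weight /z !natrM.
  have tn0 : t != 0 by rewrite gt_eqF.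
  have Nn0 : N%:R != 0 :> R by rewrite gt_eqF.
  field; rewrite tn0 Nn0 /= gt_eqF// -natrM ltr_pwDr//.
  exact: ltW.
rewrite -[leRHS]invrK lef_pV2 ?posrE ?exprn_gt0 ?invr_gt0 ?divr_gt0 ?ltr0n//; last first.
  by rewrite addr_gt0// invr_gt0.
rewrite invf_div; apply: le_trans (_ : 1 + n%:R * z^-1 <= _); first by rewrite lerDr.
rewrite mulr_natl.
by apply: bernoulli_inequality; rewrite invr_ge0 ltW.
Qed.

(** The hypothesis bounds [E (exp (- tau / t))] from below, up to the branches still alive at depth
    [n]. Subtracting it from the total mass at [th = 0] leaves [kap] plus the discounted mass of
    those branches, which vanishes as [n] grows because [g] is at most 1. *)
Lemma prob_tau_ge_le t (kap : R) (g : seq (int * bool) -> R) : 0 < t ->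
  (forall h, g h <= 1) ->
  (forall n, 1 - kap <=
    \sum_(j < n) \sum_(h <- hists N j.+1 | first_hit 1 h) jump_weight N t^-1 ^+ j.+1
    + \sum_(h <- hists N n | (ncoll h < 1)%N) jump_weight N t^-1 ^+ n * g h) ->
  (P (tau_ge N E B x1 x2 t) <= (kap / (1 - expR (- 1)))%:E)%E.
Proof.
move=> t0 g1 Hk; have ti : 0 <= t^-1 by rewrite invr_ge0 ltW.
have e1 : 0 < 1 - expR (- 1) :> R by rewrite subr_gt0 -[ltRHS]expR0 ltr_expR oppr_lt0.
have mtau := measurable_tau_ge t.
pose p h := fine (P (nonneg_gaps `&` Hist h `&` [set w | (t <= clock h w)%R])).
rewrite -(prob_nonneg_gapsI _ _ _ _ N0 MP _ mtau).
pose D j := nonneg_gaps `&` [set w | first_hit 1 (hist_of w j.+1) /\ t <= clock (hist_of w j.+1) w].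
pose A n := nonneg_gaps `&` [set w | (ncoll (hist_of w n) < 1)%N].
have mset (b : bool) : measurable [set w : T | b].
  by case: b; [rewrite (_ : [set w | _] = setT)|rewrite (_ : [set w | _] = set0)]; rewrite //; apply/seteqP; split.
have mD j : measurable (D j).
  apply: measurableI => //; apply: (@measurable_by_hist _ _ _ N E B x1 x2 N0 mE mB j.+1 _
    (fun h w => first_hit 1 h /\ t <= clock h w)) => // h.
  by apply: measurable_and => //; exact: mge.
have mAn n : measurable (A n).
  apply: measurableI => //; apply: (@measurable_by_hist _ _ _ N E B x1 x2 N0 mE mB n _
    (fun h w => (ncoll h < 1)%N)) => // h.
(* If no collision precedes [t], either the first [n] marks contain no collision, or the first one
   among them is late. *)
have bound n : (P (nonneg_gaps `&` tau_ge N E B x1 x2 t) <=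
   (\sum_(j < n) \sum_(h <- hists N j.+1 | first_hit 1 h) p h
    + \sum_(h <- hists N n | (ncoll h < 1)%N) jump_weight N 0 ^+ n)%:E)%E.
  apply: (@le_trans _ _ (P ((\big[setU/set0]_(j < n) D j) `|` A n))).
    apply: le_measure; rewrite ?inE//; first exact: measurableI.
      by apply: measurableU => //; exact: bigsetU_measurable.
    move=> w [Ow tw]; case: (leqP 1 (ncoll (hist_of w n))) => hn; last by right.
    have [j jn fj] := first_hit_exists w 1 n isT hn.
    left; rewrite -bigcup_mkord; exists j => //; split => //; split => //.
    by have := tw j; rewrite collisionE event_timeE; apply; case/andP: fj.
  apply: le_trans (measureU2 _ _ _) _ => //; first exact: bigsetU_measurable.
  rewrite EFinD; apply: leeD.
    apply: le_trans (@content_subadditive _ _ _ P _ D n _ _ _) _ => //.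
      exact: bigsetU_measurable.
    rewrite -sumEFin; apply: lee_sum => j _.
    have DQ w : D j w -> nonneg_gaps w /\ first_hit 1 (hist_of w j.+1) /\
        [set w | (t <= clock (hist_of w j.+1) w)%R] w by [].
    apply: le_trans (prob_le_sum_hists j.+1 (first_hit 1) _ _ (mD j) (mge t) DQ) _.
    rewrite -sumEFin big_seq_cond [leRHS]big_seq_cond.
    apply: lee_sum => h /andP[hn _].
    by have [-> _] := prob_Hist_late t _ h t0 hn.
  have AQ w : A n w -> nonneg_gaps w /\ (ncoll (hist_of w n) < 1)%N /\ [set: T] w by case.
  apply: le_trans (prob_le_sum_hists n (fun h => (ncoll h < 1)%N) _ _ (mAn n) (fun _ => measurableT) AQ) _.
  rewrite -sumEFin big_seq_cond [leRHS]big_seq_cond.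
  apply: lee_sum => h /andP[hn _]; rewrite setIT.
  have PH : P (nonneg_gaps `&` Hist h) = (jump_weight N (0 : R) ^+ n)%:E by exact: prob_Hist.
  by rewrite PH.
have PE : P (nonneg_gaps `&` tau_ge N E B x1 x2 t) =
    (fine (P (nonneg_gaps `&` tau_ge N E B x1 x2 t)))%:E.
  by rewrite fineK// fin_num_measure//; exact: measurableI.
rewrite PE lee_fin; set X := fine _ in PE *.
rewrite ler_pdivlMr// mulrC.
apply: (@ler_of_le_addV _ _ _ ((2 * N)%:R * N%:R ^+ 2 * t)) => n n0.
have {bound} := bound n; rewrite PE lee_fin -(ler_pM2l e1) => /le_trans; apply.
have b1 : (1 - expR (- 1)) * (\sum_(j < n) \sum_(h <- hists N j.+1 | first_hit 1 h) p h) <=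
    \sum_(j < n) \sum_(h <- hists N j.+1 | first_hit 1 h)
      (jump_weight N 0 ^+ j.+1 - jump_weight N t^-1 ^+ j.+1).
  rewrite mulr_sumr; apply: ler_sum => j _; rewrite mulr_sumr big_seq_cond [leRHS]big_seq_cond.
  by apply: ler_sum => h /andP[hn _]; have [_] := prob_Hist_late t _ h t0 hn.
have b2 : (1 - expR (- 1)) * (\sum_(h <- hists N n | (ncoll h < 1)%N) jump_weight N 0 ^+ n) <=
   \sum_(h <- hists N n | (ncoll h < 1)%N) jump_weight N (0 : R) ^+ n.
  apply: ler_piMl; last by rewrite lerBlDr lerDl expR_ge0.
  by rewrite sumr_ge0// => h _; rewrite exprn_ge0// jump_weight_ge0.
have b3 : \sum_(h <- hists N n | (ncoll h < 1)%N) jump_weight N t^-1 ^+ n * g h <=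
    (2 * N)%:R * N%:R ^+ 2 * t / n%:R.
  apply: le_trans (total_weight_le t n t0 n0).
  have jw := exprn_ge0 n (jump_weight_ge0 N _ ti).
  rewrite -sum_hists_cst big_mkcond; apply: ler_sum => h _.
  by case: ifP => // _; rewrite ler_piMr.
have b4 := sum_hists_jump_weight0 n.
have b5 := Hk n.
have E0 : \sum_(j < n) \sum_(h <- hists N j.+1 | first_hit 1 h)
      (jump_weight N 0 ^+ j.+1 - jump_weight N t^-1 ^+ j.+1) =
  \sum_(j < n) \sum_(h <- hists N j.+1 | first_hit 1 h) jump_weight N 0 ^+ j.+1 -
  \sum_(j < n) \sum_(h <- hists N j.+1 | first_hit 1 h) jump_weight N t^-1 ^+ j.+1.
  by rewrite -sumrB; apply: eq_bigr => j _; rewrite sumrB.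
rewrite E0 in b1; rewrite mulrDr; lra.
Qed.

End collision_times.

(** * The two walkers *)

Section two_walkers.
Context {R : realType}.
Variables (N : nat) (x1 x2 : int).
Implicit Type h : seq (int * bool).

(** Exchanging two adjacent particles does not change the set of occupied sites. In the ordered
    positions a mark at the occupied pair is therefore no move, active or not, and every other
    exchange preserves the order. *)
Definition lo (p : int * int) : int := Num.min p.1 p.2.
Definition hi (p : int * int) : int := Num.max p.1 p.2.

Definition positions h : int * int := (hstate x1 x2 h).2.
Local Notation pos := positions.

Lemma hist_pos (n : nat) h : in_Lambda N x1 -> in_Lambda N x2 -> x1 != x2 -> h \in hists N n ->
  [/\ - N%:Z <= lo (pos h), lo (pos h) < hi (pos h) & hi (pos h) <= N%:Z].
Proof.
move=> L1 L2 ne; suff : h \in hists N n ->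
    [/\ in_Lambda N (pos h).1, in_Lambda N (pos h).2 & (pos h).1 != (pos h).2].
  move=> H /H; rewrite /in_Lambda /lo /hi /Order.min /Order.max.
  by case: (pos h) => a b /= [] ? ? ?; case: ifP => ?; split; lia.
elim: n h => [|n IH] h; first by rewrite inE => /eqP->.
case: h => [|[e b] h]; first by move/size_hists.
rewrite mem_histsS => /andP[/= es /IH]; move: es; rewrite mem_inner_edges.
rewrite /positions /=; case: (hstate x1 x2 h) => c [a a'] /=; case: b => //=.
rewrite /in_Lambda /swap_site => e1 [] ? ? ?.
by do ?[case: ifP => ?]; split; lia.
Qed.

Lemma hcoll_cons e b h : lo (pos h) < hi (pos h) ->
  hcoll x1 x2 ((e, b) :: h) = (hi (pos h) == lo (pos h) + 1) && (e == lo (pos h)).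
Proof.
rewrite /positions /= /lo /hi; case: (hstate x1 x2 h) => c [a a'] /=.
rewrite /Order.min /Order.max; case: ifP => ? ?; apply/idP/idP; lia.
Qed.

Lemma pos_false e h : pos ((e, false) :: h) = pos h.
Proof. by []. Qed.

Lemma swap_siteP e p : [\/ p = e /\ swap_site e p = e + 1,
  p = e + 1 /\ swap_site e p = e | [/\ p <> e, p <> e + 1 & swap_site e p = p]].
Proof.
rewrite /swap_site; case: eqVneq => [|/eqP ne]; first by constructor 1.
by case: eqVneq => [|/eqP ne1]; [constructor 2|constructor 3].
Qed.

Lemma lo_hi_true e h : lo (pos h) < hi (pos h) ->
  (lo (pos ((e, true) :: h)), hi (pos ((e, true) :: h))) =
  if (hi (pos h) == lo (pos h) + 1) && (e == lo (pos h)) then (lo (pos h), hi (pos h))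
  else (swap_site e (lo (pos h)), swap_site e (hi (pos h))).
Proof.
rewrite /positions /=; case: (hstate x1 x2 h) => c [a a'] /=.
rewrite /lo /hi /= => H; set b := (_ && _).
have E0 : b = (Num.max a a' == Num.min a a' + 1) && (e == Num.min a a') by [].
move: H E0; clearbody b; rewrite /Order.min /Order.max.
case: (ltP a a') => H1 H2; case: b => E0; move: (swap_siteP e a) (swap_siteP e a');
  move: (swap_site e a) (swap_site e a') => u u' [[? ?]|[? ?]|[? ? ?]] [[? ?]|[? ?]|[? ? ?]];
  case: (ltP u u') => ?; congr (_, _); move: E0; lia.
Qed.

Lemma sum_inner_edges_if (a : int) (c : R) :
  \sum_(e <- inner_edges N) (if e == a then c else 0) = if a \in inner_edges N then c else 0.
Proof.
have [ai|na] := boolP (a \in inner_edges N); last first.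
  rewrite big_seq big1// => e ei; case: eqP => // ea; by rewrite -ea ei in na.
rewrite (bigD1_seq a) ?inner_edges_uniq//= eqxx big1 ?addr0// => e /negbTE ->.
by [].
Qed.

Lemma swap_site_left p : swap_site p p = p + 1.
Proof. by rewrite /swap_site eqxx. Qed.

Lemma swap_site_right p : swap_site (p - 1) p = p - 1.
Proof. by case: (swap_siteP (p - 1) p) => [[? ?]|[? ?]|[? ? ?]] //; lia. Qed.

Lemma swap_site_id e p : e != p -> e != p - 1 -> swap_site e p = p.
Proof. by move=> ? ?; case: (swap_siteP e p) => [[? ?]|[? ?]|[? ? ?]] //; lia. Qed.

(* Only the four pairs next to a walker contribute; at the ends of the box the outward
   pair is missing. *)
Lemma sum_inner_edges_drift (V : int -> int -> R) (c : R) (l k : int) :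
  - N%:Z <= l -> l < k -> k <= N%:Z ->
  \sum_(e <- inner_edges N) (if (k == l + 1) && (e == l) then c
      else V (swap_site e l) (swap_site e k) - V l k) =
  (if - N%:Z < l then V (l - 1) k - V l k else 0)
  + (if k < N%:Z then V l (k + 1) - V l k else 0)
  + if k == l + 1 then c else (V (l + 1) k - V l k) + (V l (k - 1) - V l k).
Proof.
move=> l1 lk k2.
have in1 : (l - 1 \in inner_edges N) = (- N%:Z < l) by rewrite mem_inner_edges; lia.
have in2 : (k \in inner_edges N) = (k < N%:Z) by rewrite mem_inner_edges; lia.
have in3 : (l \in inner_edges N) = true by rewrite mem_inner_edges; lia.
have in4 : (k - 1 \in inner_edges N) = true by rewrite mem_inner_edges; lia.
(* For adjacent walkers the pairs [l] and [k - 1] coincide; the last term is then switched off so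
   that this pair is counted once. *)
have S e : (if (k == l + 1) && (e == l) then c else V (swap_site e l) (swap_site e k) - V l k) =
  (if e == l - 1 then V (l - 1) k - V l k else 0) + (if e == k then V l (k + 1) - V l k else 0)
  + (if e == l then (if k == l + 1 then c else V (l + 1) k - V l k) else 0)
  + (if e == k - 1 then (if k == l + 1 then 0 else V l (k - 1) - V l k) else 0).
  have [->|n1] := eqVneq e (l - 1).
    rewrite swap_site_right swap_site_id; [|lia|lia].
    by do ?[case: ifP => ?]; first [exfalso; lia | rewrite ?addr0 ?add0r].
  have [->|n2] := eqVneq e k.
    rewrite swap_site_left swap_site_id; [|lia|lia].
    by do ?[case: ifP => ?]; first [exfalso; lia | rewrite ?addr0 ?add0r].
  have [->|n3] := eqVneq e l.
    rewrite andbT; case: ifP => kl.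
      by do ?[case: ifP => ?]; rewrite ?addr0 ?add0r.
    rewrite swap_site_left swap_site_id; [|lia|lia].
    by do ?[case: ifP => ?]; first [exfalso; lia | rewrite ?addr0 ?add0r].
  have [e4|n4] := eqVneq e (k - 1).
    subst e.
    rewrite swap_site_right swap_site_id; [|lia|lia].
    by do ?[case: ifP => ?]; first [exfalso; lia | rewrite ?addr0 ?add0r].
  by rewrite andbF !swap_site_id ?subrr ?addr0.
under eq_bigr do rewrite S.
rewrite !big_split /= !sum_inner_edges_if in1 in2 in3 in4.
by case: (k == l + 1); rewrite -!addrA ?addr0.
Qed.

(* [c] is twice the gain at a collision; the other pairs contribute through the passive and
   the active mark. *)
Lemma sum_moves (F : seq (int * bool) -> R) (V : int -> int -> R) (A c : R) n h :
  in_Lambda N x1 -> in_Lambda N x2 -> x1 != x2 -> h \in hists N n ->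
  let l := lo (pos h) in let k := hi (pos h) in
  (forall e b, hcoll x1 x2 ((e, b) :: h) -> F ((e, b) :: h) = A * (V l k + 2^-1 * c)) ->
  (forall e b, ~~ hcoll x1 x2 ((e, b) :: h) -> F ((e, b) :: h) =
     A * V (lo (pos ((e, b) :: h))) (hi (pos ((e, b) :: h)))) ->
  \sum_(e <- inner_edges N) (F ((e, true) :: h) + F ((e, false) :: h)) =
  A * ((4 * N)%:R * V l k +
   ((if - N%:Z < l then V (l - 1) k - V l k else 0)
  + (if k < N%:Z then V l (k + 1) - V l k else 0)
  + if k == l + 1 then c else (V (l + 1) k - V l k) + (V l (k - 1) - V l k))).
Proof.
move=> L1 L2 ne hn l k F1 F2.
have [l1 lk k2] := hist_pos n h L1 L2 ne hn.
rewrite -sum_inner_edges_drift// (eq_bigr (fun e => A * (2 * V l k + (if (k == l + 1) && (e == l) then c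
      else V (swap_site e l) (swap_site e k) - V l k)))); last first.
  move=> e _; have C b := hcoll_cons e b h lk; have := lo_hi_true e h lk.
  rewrite -/l -/k in C *; case: ifP => cl.
    by move=> _; rewrite !F1 ?C ?cl//; field.
  by move=> [E1 E2]; rewrite !F2 ?C ?cl// E1 E2 pos_false -/l -/k; ring.
rewrite -mulr_sumr big_split /= big_const_seq count_predT iter_addr_0 size_inner_edges.
by congr (_ * (_ + _)); rewrite -[LHS]mulr_natl mulrA -natrM; congr (_%:R * _); lia.
Qed.

End two_walkers.

Lemma jump_weightE (R : realType) (N : nat) (kap : R) : (0 < N)%N ->
  jump_weight N (kap ^+ 2 * N%:R ^+ 2) = (2 * ((2 * N)%:R + kap ^+ 2))^-1.
Proof.
move=> N0; have n0 : N%:R != 0 :> R by rewrite pnatr_eq0 -lt0n.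
have p0 : 2 * N%:R + kap ^+ 2 != 0 :> R.
  by rewrite gt_eqF// ltr_pwDl ?sqr_ge0// mulr_gt0// ltr0n.
rewrite /jump_weight natrM -mulrDl; field.
by rewrite n0 p0.
Qed.

Lemma exprz_add1 (F : fieldType) (x : F) (n : int) : x != 0 -> x ^ (n + 1) = x ^ n * x.
Proof. by move=> x0; rewrite expfzDr// expr1z. Qed.

Lemma exprz_sub1 (F : fieldType) (x : F) (n : int) : x != 0 -> x ^ (n - 1) = x ^ n / x.
Proof. by move=> x0; rewrite expfzDr// -invr_expz expr1z. Qed.

Lemma ncoll_cons x1 x2 p h : ncoll x1 x2 (p :: h) = (hcoll x1 x2 (p :: h) + ncoll x1 x2 h)%N.
Proof. by []. Qed.

(** * The discounted first collision *)

Section meeting_time.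
Context {R : realType}.
Variables (N : nat) (x1 x2 : int) (kap : R).
Hypotheses (N0 : (0 < N)%N) (k0 : 0 < kap) (k1 : kap < 1).
Hypotheses (L1 : in_Lambda N x1) (L2 : in_Lambda N x2) (ne : x1 != x2).

Let V (l k : int) : R := (1 - kap) ^ (k - l).

Definition never_met (h : seq (int * bool)) : R :=
  if ncoll x1 x2 h == 0%N then
    (1 - kap) ^ (hi (positions x1 x2 h) - lo (positions x1 x2 h)) else 1.

(** With [v] the current value, four moves at distance at least 2 give
    [2 * v * kap ^ 2 / (1 - kap)], more than the required [2 * v * kap ^ 2]. For adjacent walkers
    [v = 1 - kap]: the two outward moves cost at most [2 * v * kap] and the jump to 1 brings
    [2 * kap], which leaves [2 * kap ^ 2]. *)
Lemma never_met_subharmonic n h : h \in hists N n -> (ncoll x1 x2 h < 1)%N ->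
  never_met h <= jump_weight N (kap ^+ 2 * N%:R ^+ 2) *
    \sum_(e <- inner_edges N) (never_met ((e, true) :: h) + never_met ((e, false) :: h)).
Proof.
rewrite ltnS leqn0 => hn /eqP h0.
have [l1 lk l2] := hist_pos N x1 x2 n h L1 L2 ne hn.
set l := lo (positions x1 x2 h) in l1 lk *; set k := hi (positions x1 x2 h) in lk l2 *.
rewrite (sum_moves N x1 x2 never_met V 1 (2 * (1 - V l k)) n h L1 L2 ne hn); first last.
- by move=> e b nc; rewrite /never_met ncoll_cons h0 (negbTE nc) mul1r.
- by move=> e b hc; rewrite /never_met ncoll_cons h0 hc /= mul1r -/l -/k; field.
have r0 : 0 < 1 - kap by rewrite subr_gt0.
have rn : 1 - kap != 0 by rewrite gt_eqF.
have v0 : 0 < V l k by rewrite exprz_gt0.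
have Vl1 : V (l - 1) k = V l k * (1 - kap).
  by rewrite /V -exprz_add1//; congr (_ ^ _); lia.
have Vk1 : V l (k + 1) = V l k * (1 - kap).
  by rewrite /V -exprz_add1//; congr (_ ^ _); lia.
have Vl2 : V (l + 1) k = V l k / (1 - kap).
  by rewrite /V -exprz_sub1//; congr (_ ^ _); lia.
have Vk2 : V l (k - 1) = V l k / (1 - kap).
  by rewrite /V -exprz_sub1//; congr (_ ^ _); lia.
rewrite /never_met h0 eqxx -/l -/k -/(V l k) mul1r jump_weightE//.
have w0 : 0 < 2 * ((2 * N)%:R + kap ^+ 2) :> R.
  by rewrite mulr_gt0// ltr_pwDl ?sqr_ge0// ltr0n muln_gt0.
rewrite mulrC ler_pdivlMr//.
rewrite [leLHS](_ : _ = (4 * N)%:R * V l k + 2 * kap ^+ 2 * V l k); last by rewrite !natrM; ring.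
rewrite lerD2l Vl1 Vk1 Vl2 Vk2.
set v := V l k in v0 *.
have q0 : 0 <= v * kap by rewrite mulr_ge0// ltW.
(* At an end of the box the missing outward move contributes 0 in place of a loss. *)
have b1 : - (v * kap) <= (if - N%:Z < l then v * (1 - kap) - v else 0).
  by case: ifP => _; [lra|rewrite oppr_le0].
have b2 : - (v * kap) <= (if k < N%:Z then v * (1 - kap) - v else 0).
  by case: ifP => _; [lra|rewrite oppr_le0].
set B1 := (if _ then _ else _) in b1 *; set B2 := (if k < N%:Z then _ else _) in b2 *.
case: ifP => kl.
  have vE : v = 1 - kap by rewrite /v /V (eqP kl) addrAC subrr add0r expr1z.
  rewrite vE in b1 b2 *.
  have c0 : 0 <= kap ^+ 3 by rewrite exprn_ge0// ltW.
  apply: le_trans (lerD (lerD b1 b2) (lexx _)).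
  rewrite -subr_ge0 (_ : _ - _ = 2 * kap ^+ 3); last by ring.
  by rewrite mulr_ge0.
apply: le_trans (lerD (lerD b1 b2) (lexx _)).
rewrite -subr_ge0 (_ : _ - _ = 2 * (v * kap * (kap * kap)) / (1 - kap)); last by field.
by rewrite divr_ge0 ?mulr_ge0// ltW.
Qed.

Lemma never_met_le1 h : never_met h <= 1.
Proof.
rewrite /never_met; case: ifP => // _.
have : 0 <= hi (positions x1 x2 h) - lo (positions x1 x2 h).
  by rewrite subr_ge0 /hi /lo le_max ge_min lexx.
case: (_ - _) => // n _; rewrite -exprnP exprn_ile1//; first by rewrite subr_ge0 ltW.
by rewrite lerBlDr lerDl ltW.
Qed.

Lemma prob_tau_ge_sqrt {d : measure_display} {T : measurableType d} (P : probability T R)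
    (E : int -> nat -> T -> R) (B : int -> nat -> T -> bool) (t : R) :
  marks_process N P E B -> 0 < t -> t^-1 = kap ^+ 2 * N%:R ^+ 2 -> `|x1 - x2| = 1 ->
  (P (tau_ge N E B x1 x2 t) <= (kap / (1 - expR (- 1)))%:E)%E.
Proof.
move=> MP t0 tE adj.
apply: (prob_tau_ge_le N P E B x1 x2 N0 MP t kap never_met t0 never_met_le1) => n.
have -> : 1 - kap = never_met [::].
  rewrite /never_met /= /positions /= (_ : hi _ - lo _ = 1) ?expr1z//.
  by move: adj; rewrite /hi /lo /Order.max /Order.min /=; case: ifP; lia.
have w0 : 0 <= jump_weight N t^-1 :> R by apply: jump_weight_ge0; rewrite invr_ge0 ltW.
apply: le_trans (sum_tree_ge N x1 x2 _ never_met 1 n w0 isT _) _.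
  by move=> m h hm h0; rewrite tE; exact: never_met_subharmonic hm h0.
rewrite lerD2r; apply: ler_sum => j _; apply: ler_sum => h fh.
by rewrite ler_piMr ?exprn_ge0// never_met_le1.
Qed.

End meeting_time.

Lemma box_bounds (N : nat) (l k : int) : - N%:Z <= l -> l < k -> k <= N%:Z ->
  [/\ 2 - (k - l) <= 1, k - N%:Z <= 0 & - l - N%:Z <= 0].
Proof. by move=> *; split; lia. Qed.

Lemma box_left_end (N : nat) (l : int) : - N%:Z <= l -> (- N%:Z < l) = false -> - l - N%:Z = 0.
Proof. lia. Qed.

Lemma box_right_end (N : nat) (k : int) : k <= N%:Z -> (k < N%:Z) = false -> k - N%:Z = 0.
Proof. lia. Qed.

Lemma far_pair (l k : int) : l < k -> k != l + 1 -> 2 - (k - l) <= 0.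
Proof. lia. Qed.

Lemma adjacent_pair (N : nat) (l : int) : (0 < N)%N ->
  l + 1 - N%:Z + (- l - N%:Z) = - (2 * N - 1)%N%:Z.
Proof. lia. Qed.

Lemma leq_double_pred (N : nat) : (0 < N)%N -> (N <= 2 * N - 1)%N.
Proof. lia. Qed.

(** * An exponential moment of the number of collisions *)

Section collision_count.
Context {R : realType}.
Variables (N : nat) (x1 x2 : int) (kap del : R).
Hypotheses (N0 : (0 < N)%N) (k0 : 0 < kap) (k1 : kap <= 1) (d0 : 0 < del).
Hypothesis Nk : del <= 1 - (1 + N%:R * kap)^-1.
Hypotheses (L1 : in_Lambda N x1) (L2 : in_Lambda N x2) (ne : x1 != x2).

Let q : R := 1 + kap.

(* The first exponential pays for the collisions; the other two correct it near the ends of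
   the box, where the reflection would push the walkers towards each other. *)
Definition collision_potential (l k : int) : R :=
  1 + q ^ (2 - (k - l)) + q ^ (k - N%:Z) + q ^ (- l - N%:Z).

Let V := collision_potential.

Let q1 : 1 <= q. Proof. by rewrite lerDl ltW. Qed.
Let q0 : 0 < q. Proof. by rewrite ltr_pwDl// ltW. Qed.
Let qn : q != 0. Proof. by rewrite gt_eqF. Qed.

Let qz_le1 (m : int) : m <= 0 -> q ^ m <= 1.
Proof. by move=> m0; rewrite -(expr0z q); exact: ler_weXz2l. Qed.

Lemma collision_potential_ge1 l k : 1 <= V l k.
Proof. by rewrite /V /collision_potential -!addrA lerDl !addr_ge0// exprz_ge0// ltW. Qed.

Lemma collision_potential_le5 l k : - N%:Z <= l -> l < k -> k <= N%:Z -> V l k <= 5.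
Proof.
move=> l1 lk k2; have [h1 h2 h3] := box_bounds N l k l1 lk k2.
have a1 : q ^ (2 - (k - l)) <= q by rewrite -[leRHS]expr1z; exact: ler_weXz2l.
have b1 : q ^ (k - N%:Z) <= 1 by exact: qz_le1.
have c1 : q ^ (- l - N%:Z) <= 1 by exact: qz_le1.
by rewrite /V /collision_potential; move: k1 a1; rewrite /q; lra.
Qed.

(** The constant 10 is twice the upper bound 5 on [V]: the reward [2 * (b - 1) * V] is then at most
    [kap * del], the downward drift available when the walkers are adjacent. *)
Definition weighted_collisions (h : seq (int * bool)) : R :=
  (1 + kap * del / 10) ^+ ncoll x1 x2 h *
    V (lo (positions x1 x2 h)) (hi (positions x1 x2 h)).

(** Away from collisions each exponential term gains [kap ^ 2 / q] times itself per walker that it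
    involves, within the allowed [2 * kap ^ 2 * V]. For adjacent walkers the inward moves are absent
    and the outward ones give [kap * (c + f - 2)]; being 1 at their own end, [c] and [f] keep this
    formula valid at the walls. *)
Lemma weighted_collisions_superharmonic n h : h \in hists N n ->
  jump_weight N (kap ^+ 2 * N%:R ^+ 2) * \sum_(e <- inner_edges N)
    (weighted_collisions ((e, true) :: h) + weighted_collisions ((e, false) :: h))
  <= weighted_collisions h.
Proof.
move=> hn; have [l1 lk k2] := hist_pos N x1 x2 n h L1 L2 ne hn.
set b := 1 + kap * del / 10.
have lkE e' b' : hcoll x1 x2 ((e', b') :: h) ->
    (lo (positions x1 x2 ((e', b') :: h)), hi (positions x1 x2 ((e', b') :: h))) =
    (lo (positions x1 x2 h), hi (positions x1 x2 h)).
  by rewrite hcoll_cons//; case: b' => //; rewrite lo_hi_true// => ->.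
set l := lo (positions x1 x2 h) in l1 lk lkE *; set k := hi (positions x1 x2 h) in lk k2 lkE *.
rewrite (sum_moves N x1 x2 weighted_collisions V (b ^+ ncoll x1 x2 h)
  (2 * (b - 1) * V l k) n h L1 L2 ne hn); first last.
- by move=> e' b' nc; rewrite /weighted_collisions ncoll_cons (negbTE nc).
- move=> e' b' hc; rewrite /weighted_collisions ncoll_cons hc /= add1n exprS.
  by have [-> ->] := lkE _ _ hc; rewrite -/b -/l -/k; field.
rewrite /weighted_collisions -/b -/l -/k mulrCA ler_wpM2l//.
  by rewrite exprn_ge0// addr_ge0// !mulr_ge0 ?invr_ge0// ltW.
rewrite jump_weightE//.
have w0 : 0 < 2 * ((2 * N)%:R + kap ^+ 2) :> R.
  by rewrite mulr_gt0// ltr_pwDl ?sqr_ge0// ltr0n muln_gt0.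
rewrite mulrC ler_pdivrMr//.
rewrite [leRHS](_ : _ = (4 * N)%:R * V l k + 2 * kap ^+ 2 * V l k); last by rewrite !natrM; ring.
rewrite lerD2l.
pose a := q ^ (2 - (k - l)); pose c := q ^ (k - N%:Z); pose f := q ^ (- l - N%:Z).
have VE : V l k = 1 + a + c + f by [].
have Vl1 : V (l - 1) k = 1 + a / q + c + f * q.
  by rewrite /V /collision_potential -exprz_sub1// -exprz_add1//; congr (1 + _ ^ _ + _ + _ ^ _); ring.
have Vk1 : V l (k + 1) = 1 + a / q + c * q + f.
  by rewrite /V /collision_potential -exprz_sub1// -exprz_add1//; congr (1 + _ ^ _ + _ ^ _ + _); ring.
have Vl2 : V (l + 1) k = 1 + a * q + c + f / q.
  by rewrite /V /collision_potential -exprz_sub1// -exprz_add1//; congr (1 + _ ^ _ + _ + _ ^ _); ring.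
have Vk2 : V l (k - 1) = 1 + a * q + c / q + f.
  by rewrite /V /collision_potential -exprz_sub1// -exprz_add1//; congr (1 + _ ^ _ + _ ^ _ + _); ring.
have [h21 hk hl] := box_bounds N l k l1 lk k2.
have V5 := collision_potential_le5 l k l1 lk k2.
rewrite Vl1 Vk1 Vl2 Vk2 in V5 *.
have a0 : 0 < a by rewrite exprz_gt0.
have c0 : 0 < c by rewrite exprz_gt0.
have f0 : 0 < f by rewrite exprz_gt0.
have [kl|kl] := eqVneq k (l + 1).
  have aq : a = q by rewrite /a kl (_ : 2 - _ = 1) ?expr1z//; ring.
  have f1 : f <= 1 by exact: qz_le1.
  have c1 : c <= 1 by exact: qz_le1.
  have B1 : (if - N%:Z < l then 1 + a / q + c + f * q - V l k else 0) = kap * (f - 1).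
    case: ifP => Nl; first by rewrite VE aq mulfV// /q; ring.
    have -> : f = 1 by rewrite /f (box_left_end N l l1 Nl) expr0z.
    by rewrite subrr mulr0.
  have B2 : (if k < N%:Z then 1 + a / q + c * q + f - V l k else 0) = kap * (c - 1).
    case: ifP => Nl; first by rewrite VE aq mulfV// /q; ring.
    have -> : c = 1 by rewrite /c (box_right_end N k k2 Nl) expr0z.
    by rewrite subrr mulr0.
  rewrite B1 B2.
  (* Adjacent walkers cannot be close to both ends: [c * f = q ^ - (2 * N - 1)]. Together with
     [(1 - c) * (1 - f) >= 0] this keeps [c + f] below [2 - del]. *)
  have cf : c * f <= 1 - del.
    rewrite /c /f kl -expfzDr// adjacent_pair//.
    rewrite -invr_expz -exprnP.
    apply: le_trans (_ : (1 + N%:R * kap)^-1 <= _); last by move: Nk; lra.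
    have h1 : 0 < 1 + N%:R * kap by rewrite ltr_pwDl// mulr_ge0// ltW.
    rewrite lef_pV2 ?posrE ?exprn_gt0//.
    apply: le_trans (_ : q ^+ N <= _); last by apply: ler_weXn2l => //; exact: leq_double_pred.
    by rewrite /q mulr_natl; apply: bernoulli_inequality; exact: ltW.
  have sgn : 0 <= (1 - c) * (1 - f) by rewrite mulr_ge0// subr_ge0.
  have h1 : f + c - 2 <= - del by move: sgn cf; rewrite mulrBl mul1r mulrBr mulr1; lra.
  have h2 : kap * (f + c - 2) <= kap * - del by rewrite ler_wpM2l// ltW.
  have h3 : 2 * (b - 1) * V l k <= kap * del.
    rewrite (_ : 2 * (b - 1) = kap * del / 5); last by rewrite /b; field.
    by rewrite -mulrA ler_piMr ?mulr_ge0 ?(ltW k0) ?(ltW d0)//; rewrite VE in V5 *; lra.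
  have h4 : 0 <= 2 * kap ^+ 2 * V l k.
    apply: mulr_ge0; first by rewrite mulr_ge0 ?sqr_ge0.
    exact: le_trans (collision_potential_ge1 l k).
  by move: h2 h3 h4; rewrite mulrDr mulrDr; lra.
have a1 : a <= 1 by apply: qz_le1; exact: far_pair.
have qV : 1 - q^-1 = kap / q by rewrite /q; field.
have e1 : 0 <= kap * (1 - q^-1) by rewrite qV mulr_ge0 ?divr_ge0 ?(ltW k0) ?(ltW q0).
have aq : a * (kap * q^-1) <= kap * q^-1 by rewrite ler_piMl// divr_ge0 ?(ltW k0) ?(ltW q0).
(* At the wall [f = 1], and since [a <= 1] for walkers that are not adjacent, the formula for an
   interior site still bounds the missing move. *)
have B1 : (if - N%:Z < l then 1 + a / q + c + f * q - V l k else 0) <=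
    (q - 1) * f - a * (1 - q^-1).
  case: ifP => Nl; first by rewrite VE le_eqVlt; apply/orP; left; apply/eqP; ring.
  have -> : f = 1 by rewrite /f (box_left_end N l l1 Nl) expr0z.
  by rewrite qV mulr1 /q subr_ge0; move: e1 aq; rewrite /q; lra.
have B2 : (if k < N%:Z then 1 + a / q + c * q + f - V l k else 0) <=
    (q - 1) * c - a * (1 - q^-1).
  case: ifP => Nl; first by rewrite VE le_eqVlt; apply/orP; left; apply/eqP; ring.
  have -> : c = 1 by rewrite /c (box_right_end N k k2 Nl) expr0z.
  by rewrite qV mulr1 /q subr_ge0; move: e1 aq; rewrite /q; lra.
apply: le_trans (lerD (lerD B1 B2) (lexx _)) _.
rewrite /= VE [leLHS](_ : _ = kap ^+ 2 / q * (2 * a + c + f)); last by rewrite /q; field.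
apply: le_trans (_ : kap ^+ 2 * (2 * a + c + f) <= _).
  rewrite ler_wpM2r ?addr_ge0 ?mulr_ge0 ?(ltW a0) ?(ltW c0) ?(ltW f0)//.
  by rewrite ler_piMr ?sqr_ge0// invf_le1.
rewrite -mulrA mulrCA ler_wpM2l ?sqr_ge0//; lra.
Qed.

(** With [y = kap * del / 10], the weighted potential is at least [(1 + y) ^ m] at an [m]-th
    collision and at most 5 at the root. The 20 comes from [exp (y / 2) <= 1 + y], valid for
    [0 <= y <= 1]. *)
Lemma prob_Ncoll_ge_exp {d : measure_display} {T : measurableType d} (P : probability T R)
    (E : int -> nat -> T -> R) (B : int -> nat -> T -> bool) (t r : R) :
  marks_process N P E B -> 0 < t -> 0 < r -> t^-1 = kap ^+ 2 * N%:R ^+ 2 ->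
  (P (Ncoll_ge N E B x1 x2 t r) <=
    (expR 1 * (5 * expR (- (r * kap * del / 20))))%:E)%E.
Proof.
move=> MP t0 r0 tE; apply: (prob_Ncoll_ge_le N P E B x1 x2 N0 MP t r _ t0 r0) => m n m0 rm.
have w0 : 0 <= jump_weight N t^-1 :> R by apply: jump_weight_ge0; rewrite invr_ge0 ltW.
have d1 : del <= 1.
  apply: le_trans Nk _; rewrite lerBlDr lerDl invr_ge0 addr_ge0// mulr_ge0//; exact: ltW.
set y := kap * del / 10.
have y0 : 0 <= y by rewrite !mulr_ge0 ?invr_ge0 ?(ltW k0) ?(ltW d0).
have kd1 : kap * del <= 1 by rewrite mulr_ile1 ?(ltW k0) ?(ltW d0).
have y1 : y <= 1 by rewrite /y; move: kd1; lra.
have ey : expR (y / 2) <= 1 + y.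
  have h1 : 1 - y / 2 <= expR (- (y / 2)) by exact: expRN_ge.
  have h2 : 0 < 1 - y / 2 by lra.
  rewrite -[leLHS]invrK -expRN; apply: le_trans (_ : (1 - y / 2)^-1 <= _).
    by rewrite lef_pV2 ?posrE ?expR_gt0.
  rewrite -(ler_pM2l h2) divff ?gt_eqF// -subr_ge0.
  rewrite (_ : _ - 1 = y * (1 - y) / 2); last by field.
  by rewrite divr_ge0// mulr_ge0// subr_ge0.
have em : expR (r * kap * del / 20) <= (1 + y) ^+ m.
  apply: le_trans (_ : expR (m%:R * (y / 2)) <= _).
    rewrite ler_expR (_ : r * kap * del / 20 = r * (y / 2)); last by rewrite /y; field.
    by rewrite ler_wpM2r// divr_ge0.
  by rewrite expRM_natl lerXn2r ?nnegrE ?expR_ge0// addr_ge0.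
have [l1 lk k2] := hist_pos N x1 x2 0 [::] L1 L2 ne (mem_head _ _).
have root : weighted_collisions [::] <= 5.
  by rewrite /weighted_collisions expr0 mul1r collision_potential_le5.
have b0 : 0 <= (1 + y) ^+ m by rewrite exprn_ge0// addr_ge0.
have F0 h : 0 <= weighted_collisions h.
  by apply: mulr_ge0; [rewrite exprn_ge0 ?addr_ge0|exact: le_trans (collision_potential_ge1 _ _)].
have sum : (1 + y) ^+ m *
    \sum_(j < n) \sum_(h <- hists N j.+1 | first_hit x1 x2 m h) jump_weight N t^-1 ^+ j.+1 <= 5.
  apply: le_trans root; apply: le_trans (sum_tree_le N x1 x2 _ weighted_collisions m n w0 m0 _).
    apply: le_trans (_ : \sum_(j < n) \sum_(h <- hists N j.+1 | first_hit x1 x2 m h)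
      jump_weight N t^-1 ^+ j.+1 * weighted_collisions h <= _); last first.
      by rewrite lerDl sumr_ge0// => h _; rewrite mulr_ge0 ?exprn_ge0.
    rewrite mulr_sumr; apply: ler_sum => j _; rewrite mulr_sumr; apply: ler_sum => h /andP[/eqP hm _].
    rewrite mulrC ler_wpM2l ?exprn_ge0// /weighted_collisions hm.
    by rewrite ler_peMr// collision_potential_ge1.
  by move=> k h hk _; rewrite tE; exact: weighted_collisions_superharmonic hk.
rewrite expRN ler_pdivlMr ?expR_gt0// mulrC; apply: le_trans sum; apply: ler_wpM2r em.
by rewrite sumr_ge0// => j _; rewrite sumr_ge0// => h _; rewrite exprn_ge0.
Qed.

End collision_count.

(** * Choice of the constants in the two estimates *)

Theorem theorem4p4 (R : realType) :
  (exists c : R, forall (N : nat), (0 < N)%N -> forall t : R, 0 <= t ->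
     forall (d : measure_display) (T : measurableType d) (P : probability T R)
            (E : int -> nat -> T -> R) (B : int -> nat -> T -> bool),
     marks_process N P E B ->
     forall x1 x2 : int, in_Lambda N x1 -> in_Lambda N x2 -> `|x1 - x2| = 1 ->
     (P (tau_ge N E B x1 x2 t) <=
        (c / (Num.sqrt ((N%:R) ^+ 2 * t) + 1))%:E)%E)
  /\
  (forall (Tmax : R), 0 < Tmax -> forall (zeta : R), 0 < zeta ->
   forall k : nat, (1 <= k)%N ->
   exists c : R, forall t : R, 0 < t -> t <= Tmax ->
     forall (N : nat), (0 < N)%N ->
     forall (d : measure_display) (T : measurableType d) (P : probability T R)
            (E : int -> nat -> T -> R) (B : int -> nat -> T -> bool),
     marks_process N P E B ->
     forall x1 x2 : int, in_Lambda N x1 -> in_Lambda N x2 -> x1 != x2 ->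
     (P (Ncoll_ge N E B x1 x2 t (((N%:R) ^+ 2 * t) `^ (2^-1 + zeta))) <=
        (c * ((N%:R) ^+ 2 * t) ^- k)%:E)%E).
Proof.
have sqrt_gap (N : nat) (t : R) : (0 < N)%N -> 0 < t ->
    t^-1 = (Num.sqrt (N%:R ^+ 2 * t))^-1 ^+ 2 * N%:R ^+ 2.
  move=> N0 t0; have n0 : N%:R != 0 :> R by rewrite pnatr_eq0 -lt0n.
  rewrite exprVn sqr_sqrtr ?mulr_ge0 ?sqr_ge0 ?(ltW t0)//.
  by field; rewrite n0 gt_eqF.
split.
(* For [s <= 1] the bound 1 requires a constant at least 2. For [s > 1], [1 - exp (- 1) >= 1 / 2]
   gives [2 / sqrt s], at most [4 / (sqrt s + 1)]. *)
- exists 4 => N N0 t t0 d T P E B MP x1 x2 L1 L2 adj.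
  have ne : x1 != x2 by rewrite -subr_eq0 -normr_gt0 adj.
  set s := N%:R ^+ 2 * t.
  have mtau := measurable_tau_ge N P E B x1 x2 N0 MP t.
  have [s1|s1] := leP s 1.
    apply: le_trans (probability_le1 P mtau) _; rewrite lee_fin.
    have q0 : Num.sqrt s <= 1 by rewrite -[leRHS]sqrtr1 ler_wsqrtr.
    rewrite ler_pdivlMr ?mul1r; last by rewrite ltr_wpDl ?sqrtr_ge0.
    by apply: le_trans (lerD q0 (lexx 1)) _; rewrite -(natrD _ 1 1) ler_nat.
  have t1 : 0 < t.
    rewrite lt_neqAle t0 andbT; apply: contraTneq s1 => tz.
    by rewrite /s -tz mulr0 -leNgt.
  have q1 : 1 < Num.sqrt s by rewrite -[ltLHS]sqrtr1 ltr_sqrt// (lt_trans _ s1).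
  have q0 : 0 < Num.sqrt s by apply: lt_trans q1.
  have i0 : 0 < (Num.sqrt s)^-1 by rewrite invr_gt0.
  have i1 : (Num.sqrt s)^-1 < 1 by rewrite invf_lt1.
  apply: le_trans (prob_tau_ge_sqrt N x1 x2 _ N0 i0 i1 L1 L2 ne P E B t MP t1 (sqrt_gap N t N0 t1) adj) _.
  rewrite lee_fin; have e1 : expR (- 1) <= 2^-1 :> R by apply: le_trans (expRN_le _ _ _) _.
  apply: (@le_trans _ _ ((Num.sqrt s)^-1 * 2)).
    rewrite ler_pM2l// -[leRHS]invrK lef_pV2 ?posrE ?invr_gt0//; lra.
  rewrite mulrC ler_pdivlMr; last by rewrite addr_gt0.
  rewrite mulrAC ler_pdivrMr//; lra.
- move=> Tmax T0 zeta z0 k k1.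
  (* With [kap = 1 / (N * sqrt t)] the quantity [1 - 1 / (1 + N * kap)] equals [1 / (1 + sqrt t)],
     at least [del] for [t <= Tmax]. *)
  pose del : R := (1 + Num.sqrt Tmax)^-1.
  have d0 : 0 < del by rewrite invr_gt0 ltr_pwDl ?sqrtr_ge0.
  (* The exponential is traded for the power [(j / y) ^ j], with [y] proportional to [s ^ zeta];
     [zeta * j >= k] makes it at most a multiple of [s ^ - k] when [s > 1]. *)
  pose j := (Num.bound (k%:R / zeta)).+1.
  have jk : k%:R <= zeta * j%:R.
    rewrite mulrC -ler_pdivrMr//; apply: le_trans (_ : (Num.bound (k%:R / zeta))%:R <= _).
      by apply/ltW/archi_boundP; rewrite divr_ge0// ltW.
    by rewrite ler_nat.
  pose C : R := expR 1 * 5 * (j%:R * 20 / del) ^+ j.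
  have base0 : 0 <= j%:R * 20 / del by rewrite divr_ge0 ?mulr_ge0 ?(ltW d0).
  have C0 : 0 <= C by apply: mulr_ge0; [rewrite mulr_ge0 ?expR_ge0|exact: exprn_ge0].
  (* The summand 1 serves [s <= 1], where a probability is at most [s ^ - k]; [C] serves [s > 1]. *)
  exists (1 + C) => t t0 tT N N0 d T P E B MP x1 x2 L1 L2 ne.
  set s := N%:R ^+ 2 * t.
  have s0 : 0 < s by rewrite mulr_gt0// exprn_gt0// ltr0n.
  set r := s `^ _; have r0 : 0 < r by rewrite powR_gt0.
  have [s1|s1] := leP s 1.
    have mN := measurable_Ncoll_ge N P E B x1 x2 N0 MP t r.
    apply: le_trans (probability_le1 P mN) _; rewrite lee_fin.
    rewrite ler_pdivlMr ?exprn_gt0// mul1r; apply: le_trans (_ : 1 <= _); last by rewrite lerDl.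
    by rewrite exprn_ile1// ltW.
  have q1 : 1 < Num.sqrt s by rewrite -[ltLHS]sqrtr1 ltr_sqrt.
  have q0 : 0 < Num.sqrt s by apply: lt_trans q1.
  have i0 : 0 < (Num.sqrt s)^-1 by rewrite invr_gt0.
  have i1 : (Num.sqrt s)^-1 <= 1 by rewrite invf_le1// ltW.
  have Nd : del <= 1 - (1 + N%:R * (Num.sqrt s)^-1)^-1.
    have n0 : 0 < N%:R :> R by rewrite ltr0n.
    have st0 : 0 < Num.sqrt t by rewrite sqrtr_gt0.
    have -> : 1 - (1 + N%:R * (Num.sqrt s)^-1)^-1 = (1 + Num.sqrt t)^-1.
      rewrite /s sqrtrM ?sqr_ge0// sqrtr_sqr gtr0_norm//.
      by field; rewrite !gt_eqF// addr_gt0.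
    rewrite lef_pV2 ?posrE; [|by rewrite ltr_pwDl ?sqrtr_ge0|by rewrite addr_gt0].
    by rewrite lerD2l ler_wsqrtr.
  apply: le_trans (prob_Ncoll_ge_exp N x1 x2 _ del N0 i0 i1 d0 Nd L1 L2 ne P E B t r MP t0 r0
    (sqrt_gap N t N0 t0)) _.
  rewrite lee_fin; set y := r * _ * del / 20.
  have yE : y = s `^ zeta * (del / 20).
    rewrite /y /r powRD ?(gt_eqF s0) ?implybT// powR12_sqrt ?(ltW s0)//.
    by field; rewrite gt_eqF.
  clearbody y; have z1 : 0 < s `^ zeta by rewrite powR_gt0.
  have y0 : 0 < y by rewrite yE mulr_gt0// divr_gt0.
  have ey : expR (- y) <= (j%:R / y) ^+ j.
    have -> : expR (- y) = expR (- (y / j%:R)) ^+ j.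
      by rewrite -expRM_natl; congr expR; field; rewrite pnatr_eq0.
    have jy : 0 <= j%:R / y by rewrite divr_ge0// ltW.
    rewrite lerXn2r ?nnegrE ?expR_ge0//.
    have yj : 0 < y / j%:R by rewrite divr_gt0// ltr0n.
    apply: le_trans (expRN_le _ _ (ltW yj)) _; rewrite -[leRHS]invrK invf_div.
    by rewrite lef_pV2 ?posrE ?addr_gt0// lerDr.
  have sj : (s `^ zeta) ^- j <= s ^- k.
    rewrite lef_pV2 ?posrE ?exprn_gt0// -powR_mulrn ?(ltW s0)// -powR_mulrn ?(ltW z1)//.
    by rewrite -powRrM ler_powR// ltW.
  apply: (@le_trans _ _ (C * s ^- k)); last first.
    by rewrite ler_wpM2r ?invr_ge0 ?exprn_ge0 ?(ltW s0)// lerDr.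
  rewrite mulrA; apply: le_trans (ler_wpM2l _ ey) _; first by rewrite mulr_ge0 ?expR_ge0.
  have -> : (j%:R / y) ^+ j = (j%:R * 20 / del) ^+ j * (s `^ zeta) ^- j.
    rewrite -exprVn -exprMn; congr (_ ^+ _); rewrite yE.
    by field; rewrite !gt_eqF.
  by rewrite mulrA; apply: ler_wpM2l sj.
Qed.
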